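(* For $\lambda>0$ and $q>0$, let the knowledge points form a homogeneous Poisson point process of intensity $\lambda$ on $\mathbb{R}$, let $x$ be a uniformly drawn task independent of the knowledge points, let $\sigma^2(x)$ be the local posterior variance, and define calibrated expected utility $$U_C(\lambda,q)=\mathbb{E}\!\left[\left(1-\frac{\sigma^2(x)}{q}\right)_+\right].$$ Then: 1. $U_C(\lambda,q)$ depends on $(\lambda,q)$ only through $R\equiv 3\lambda q$, i.e. $U_C(\lambda,q)=U_C(R)$. 2. For every $R>0$, $U_C(R)>0$, and $U_C$ is strictly increasing with $$U_C'(R)=\frac{1}{R^2}\,\mathbb{E}\!\left[3\lambda\sigma^2(x)\,\mathbf{1}\{3\lambda\sigma^2(x)<R\}\right]\in\left(0,\frac{1}{R^2}\right),\qquad R>0.$$ 3. $U_C$ admits the integral representation $$U_C(R)=\int_0^1\left[1-\frac{6t(1-t)}{R}+\left(1+\frac{6t(1-t)}{R}\right)\exp\!\left(-\frac{R}{3t(1-t)}\right)\right]dt.$$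
   Context: Setting (Brownian--Poisson baseline). The truth $Y$ is a driftless Brownian motion in the task coordinate, observed exactly at the knowledge points. For a task $x$ between consecutive knowledge points $x_i<x<x_{i+1}$, the posterior variance of $Y(x)$ is $$\sigma^2(x)=\frac{(x-x_i)(x_{i+1}-x)}{x_{i+1}-x_i}.$$ A uniformly drawn task is uniformly distributed on some bounded interval of positive length, independent of the point process. Notation: $(a)_+=\max\{a,0\}$. $U_C$ is the value of a user who observes $\sigma^2(x)$ and uses the AI (payoff $1-\sigma^2(x)/q$) only when this payoff is nonnegative, taking the outside option $0$ otherwise. *)

(* Defs.v *)
From HB Require Import structures.
From mathcomp Require Import all_boot all_order all_algebra.
From mathcomp Require Import all_classical all_reals all_analysis.
Import Order.TTheory GRing.Theory Num.Theory.
Import numFieldNormedType.Exports.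

Set Implicit Arguments.
Unset Strict Implicit.
Unset Printing Implicit Defensive.

Local Open Scope classical_set_scope.
Local Open Scope ring_scope.

Definition count_event (R : realType) (Om : Type) (K : Om -> set R)
    (B : set R) (k : nat) : set Om :=
  [set w | (K w `&` B) #= `I_k]%card.

(* A simple point process is represented by the random set [K w] of its points.
   The rate of [poisson_prob] is [lam] times the length of [B]; the distribution
   does not depend on the second (nat) argument of [poisson_prob], and rate 0
   gives the Dirac mass at 0. Since the counts are discrete and the number [n]
   of sets is arbitrary, the last clause is mutual independence of the counts
   over pairwise disjoint sets. *)
Record is_poisson_process (R : realType) (d : measure_display)
    (Om : measurableType d) (P : probability Om R) (lam : R)
    (K : Om -> set R) : Prop := {
  poisson_locally_finite : forall (w : Om) (B : set R),
    bounded_set B -> finite_set (K w `&` B) ;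
  poisson_measurable : forall (B : set R) (k : nat),
    measurable B -> bounded_set B -> measurable (count_event K B k) ;
  poisson_law : forall (B : set R) (k : nat),
    measurable B -> bounded_set B ->
    P (count_event K B k) =
      poisson_prob (lam * fine (lebesgue_measure B)) 0 [set k] ;
  poisson_independent : forall (n : nat) (B : 'I_n -> set R) (k : 'I_n -> nat),
    (forall i, measurable (B i)) -> (forall i, bounded_set (B i)) ->
    trivIset setT B ->
    P (\bigcap_(i in setT) count_event K (B i) (k i)) =
      (\prod_(i < n) P (count_event K (B i) (k i)))%E }.

(* The sigma-algebra on the sample space generated by the counts. *)
Definition points_sigma (R : realType) (Om : Type) (K : Om -> set R) :
    set (set Om) :=
  <<s [set E | exists (B : set R) (k : nat),
        [/\ measurable B, bounded_set B & E = count_event K B k]] >>.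

Definition independent_of_points (R : realType) (d : measure_display)
    (Om : measurableType d) (P : probability Om R) (K : Om -> set R)
    (X : {RV P >-> R}) : Prop :=
  forall (E : set Om) (A : set R), points_sigma K E -> measurable A ->
    P (E `&` X @^-1` A) = (P E * P (X @^-1` A))%E.

Definition uniform_task (R : realType) (d : measure_display)
    (Om : measurableType d) (P : probability Om R) (X : {RV P >-> R}) : Prop :=
  exists (a b : R) (ab : a < b), forall A : set R, measurable A ->
    distribution P X A = uniform_prob ab A.

Record brownian_poisson_baseline (R : realType) (d : measure_display)
    (Om : measurableType d) (P : probability Om R) (lam : R)
    (K : Om -> set R) (X : {RV P >-> R}) : Prop := {
  baseline_points : is_poisson_process P lam K ;
  baseline_task : uniform_task X ;
  baseline_indep : independent_of_points K X }.

Definition left_point (R : realType) (S : set R) (x : R) : R :=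
  sup [set y | S y /\ y <= x].

Definition right_point (R : realType) (S : set R) (x : R) : R :=
  inf [set y | S y /\ x <= y].

(* Posterior variance of a driftless Brownian motion at [x], given its values
   on [S]. For [x] outside a locally finite [S] unbounded on both sides, the two
   points are the consecutive points of [S] with [left_point < x < right_point].
   For [x] in [S] both are [x] and the variance is [0 / 0 = 0], as it should be
   since the motion is observed at [x]. *)
Definition posterior_variance (R : realType) (S : set R) (x : R) : R :=
  (x - left_point S x) * (right_point S x - x)
    / (right_point S x - left_point S x).

Definition task_variance (R : realType) (d : measure_display)
    (Om : measurableType d) (P : probability Om R) (K : Om -> set R)
    (X : {RV P >-> R}) (w : Om) : R :=
  posterior_variance (K w) (X w).

Definition calibrated_utility (R : realType) (d : measure_display)
    (Om : measurableType d) (P : probability Om R) (K : Om -> set R)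
    (X : {RV P >-> R}) (q : R) : \bar R :=
  'E_P[(fun w => Num.max (1 - task_variance K X w / q) 0)%R]%E.

(* The point process and the task are attached to a sample space, so that
   [calibrated_utility] being a function [u] of [3 * lam * q] means that one
   [u] serves all sample spaces, intensities, costs and task intervals. *)
Definition utility_function (R : realType) (u : R -> R) : Prop :=
  forall (d : measure_display) (Om : measurableType d) (P : probability Om R)
    (lam q : R) (K : Om -> set R) (X : {RV P >-> R}),
    0 < lam -> 0 < q -> brownian_poisson_baseline lam K X ->
    calibrated_utility K X q = (u (3 * lam * q))%:E.

(* Main.v *)
(* The two gaps A and B between the task and its neighbouring knowledge points,
   multiplied by lambda, are independent standard exponential variables, for
   P(lambda A > a, lambda B > b) = exp (-(a + b)) is a void probability of the
   point process. The pair (ST, S(1 - T)), with S of density s exp (-s) and T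
   uniform on [0, 1] independent of S, has the same joint tail, so the scaled
   variance 3 lambda sigma^2 = 3 lambda AB / (A + B) has the law of the score
   V = 3 S T (1 - T), which involves no parameter. Hence U_C(R) = E (1 - V/R)_+,
   and integrating out S gives the integral representation. With
   H(R) = E [V 1{V < R}] one has, for r < s,
     (1/r - 1/s) H(r) <= U_C(s) - U_C(r) <= (1/r - 1/s) H(s);
   H is Lipschitz, so U_C'(R) = H(R)/R^2, and 0 < H(R) < E V = 1. *)
Require Import Defs.
From HB Require Import structures.
From mathcomp Require Import all_boot all_order all_algebra.
From mathcomp Require Import all_classical all_reals all_analysis.
From mathcomp Require Import measurable_realfun ring lra.
Import Order.TTheory GRing.Theory Num.Theory.
Import numFieldNormedType.Exports.
Local Open Scope classical_set_scope.
Local Open Scope ring_scope.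

Set Implicit Arguments.
Unset Strict Implicit.
Unset Printing Implicit Defensive.

(** * Gamma integrals *)

(** The Poisson law and the independence clause speak of deterministic sets, whereas the void
    interval around the task is random. Rounding the task to dyadic cells leaves countably many
    deterministic intervals, and local finiteness gives the slack that makes the rounded void events
    increase to the true one. Measurability of the neighbouring points is not part of the model: it
    is recovered from the same void events, and it has to hold everywhere, including the null event
    where a neighbour is missing and [sup] or [inf] returns 0. Differentiation under the integral
    sign is avoided. The Lipschitz bound on H is what rules out a kink of U_C, which an atom of V
    would create. The factor 3 in R is a normalisation: E V = 3 E[S] E[T(1 - T)] = 3 . 2 . 1/6 = 1,
    whence the bound 1/R^2 on the derivative. *)

Section improper_integrals.
Context {R : realType}.
Local Notation leb := (@lebesgue_measure R).

Lemma exprn_expRN_cvg0 (n : nat) :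
  x ^+ n * expR (- x) @[x --> +oo] --> (0 : R).
Proof.
apply/cvgrPdist_le => e e0; near=> x.
have x0 : 0 < x by near: x; exact: nbhs_pinfty_gt.
have xe : n.+1`!%:R / e <= x by near: x; apply: nbhs_pinfty_ge; exact: num_real.
have := expR_ge1Dxn n (ltW x0).
have f0 : 0 < n.+1`!%:R :> R by rewrite ltr0n fact_gt0.
rewrite sub0r normrN ger0_norm ?mulr_ge0 ?exprn_ge0 ?expR_ge0 ?(ltW x0)//.
rewrite expRN ler_pdivrMr ?expR_gt0// => h.
move: xe; rewrite ler_pdivrMr// => xe.
have {h} : x ^+ n.+1 / n.+1`!%:R <= expR x by rewrite (le_trans _ h)// lerDr.
rewrite ler_pdivrMr// => h.
have xn0 : 0 <= x ^+ n by rewrite exprn_ge0// ltW.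
rewrite -(ler_pM2l x0) -exprS (le_trans h)// mulrA mulrC [x * e]mulrC.
by rewrite ler_pM2r ?expR_gt0// mulrC.
Unshelve. all: by end_near. Qed.

Lemma is_derive_continuous (F : R -> R) (f : R -> R) :
  (forall x : R, is_derive x (1 : R) F (f x)) -> continuous F.
Proof.
move=> dF x; apply/differentiable_continuous/derivable1_diffP.
by have [] := dF x.
Qed.

Lemma integral_itv_pinfty (f F : R -> R) (a l : R) :
  (forall x, a <= x -> 0 <= f x) -> continuous f ->
  (forall x : R, is_derive x (1 : R) F (f x)) -> F x @[x --> +oo] --> l ->
  (\int[leb]_(x in `[a, +oo[) (f x)%:E = (l - F a)%:E)%E.
Proof.
move=> f0 cf dF Fl; rewrite EFinB; apply: ge0_continuous_FTC2y => //.
- exact: continuous_subspaceT.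
- exact/cvg_at_right_filter/(is_derive_continuous dF).
- by move=> x _; rewrite derive1E; have [] := dF x.
Qed.

Lemma integral_itv_bounded (f F : R -> R) (a b : R) : a < b ->
  continuous f -> (forall x : R, is_derive x (1 : R) F (f x)) ->
  (\int[leb]_(x in `[a, b]) (f x)%:E = (F b - F a)%:E)%E.
Proof.
move=> ab cf dF; rewrite EFinB; apply: continuous_FTC2 => //.
- exact: continuous_subspaceT.
- split; first by move=> x _; have [] := dF x.
  + exact/cvg_at_right_filter/(is_derive_continuous dF).
  + exact/cvg_at_left_filter/(is_derive_continuous dF).
- by move=> x _; rewrite derive1E; have [] := dF x.
Qed.

Lemma is_derive_expRN (x : R) : is_derive x (1 : R) (fun s => expR (- s)) (- expR (- x)).
Proof. by apply: is_derive_eq; rewrite /GRing.scale/=; ring. Qed.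

Lemma continuous_expRN : continuous (fun s : R => expR (- s)).
Proof. exact: is_derive_continuous is_derive_expRN. Qed.

(** Given S = s, both gaps exceed their bounds a and b with probability 1 - (a + b)/s; times the
    density s exp (-s) this is the integrand for c = a + b. The case c = 0 gives the total mass of
    [gamma2]. *)
Lemma integral_gamma_tail (c : R) :
  (\int[leb]_(s in `[c, +oo[) ((s - c) * expR (- s))%:E = (expR (- c))%:E)%E.
Proof.
have dF (x : R) : is_derive x (1 : R) (fun s => (c - 1 - s) * expR (- s))
    ((x - c) * expR (- x)).
  have ? := is_derive_expRN x; apply: is_derive_eq.
  by rewrite /GRing.scale/=; ring.
rewrite (integral_itv_pinfty (l := 0) _ _ dF).
- by congr EFin; ring.
- by move=> x cx; rewrite mulr_ge0 ?expR_ge0 ?subr_ge0.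
- move=> x; apply: cvgM; last exact: continuous_expRN.
  by apply: cvgB; [exact: cvg_id|exact: cvg_cst].
- rewrite (_ : (fun _ => _) =
      (fun s => (c - 1) * (s ^+ 0 * expR (- s)) - s ^+ 1 * expR (- s))); last first.
    by apply/funext => s; rewrite expr0 expr1; ring.
  rewrite -[X in _ --> X](_ : (c - 1) * 0 - 0 = 0); last by ring.
  by apply: cvgB; [apply: cvgMr|]; exact: exprn_expRN_cvg0.
Qed.

Lemma integral_gamma_mean :
  (\int[leb]_(s in `[0%R, +oo[) (s * (s * expR (- s)))%:E = 2%:E)%E.
Proof.
have dF (x : R) : is_derive x (1 : R)
    (fun s => - (s ^+ 2 + 2 * s + 2) * expR (- s)) (x * (x * expR (- x))).
  have ? := is_derive_expRN x; apply: is_derive_eq.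
  by rewrite /GRing.scale/= ?expr1; ring.
rewrite (integral_itv_pinfty (l := 0) _ _ dF).
- by rewrite oppr0 expR0; congr EFin; ring.
- by move=> x cx; rewrite !mulr_ge0 ?expR_ge0.
- move=> x; apply: cvgM; first exact: cvg_id.
  by apply: cvgM; [exact: cvg_id|exact: continuous_expRN].
- rewrite (_ : (fun _ => _) = (fun s => (- 2) * (s ^+ 0 * expR (- s))
      + (- 2) * (s ^+ 1 * expR (- s)) - s ^+ 2 * expR (- s))); last first.
    by apply/funext => s; rewrite expr0 expr1; ring.
  rewrite -[X in _ --> X](_ : (- 2) * 0 + (- 2) * 0 - 0 = 0); last by ring.
  apply: cvgB; last exact: exprn_expRN_cvg0.
  by apply: cvgD; apply: cvgMr; exact: exprn_expRN_cvg0.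
Qed.

(** This is E (1 - S/d)_+ for S of density s exp (-s), that is, the integrand of the integral
    representation once T = t is fixed and d = r/(3t(1 - t)). *)
Lemma integral_gamma_positive_part (d : R) : 0 < d ->
  (\int[leb]_(s in `[0%R, d]) ((1 - s / d) * (s * expR (- s)))%:E =
   (1 - 2 / d + (1 + 2 / d) * expR (- d))%:E)%E.
Proof.
move=> d0.
have dF (x : R) : is_derive x (1 : R)
    (fun s => (d^-1 * (s ^+ 2 + 2 * s + 2) - (s + 1)) * expR (- s))
    ((1 - x / d) * (x * expR (- x))).
  have ? := is_derive_expRN x; apply: is_derive_eq.
  by rewrite /GRing.scale/= ?expr1; ring.
rewrite (integral_itv_bounded d0 _ dF)//.
- by rewrite oppr0 expR0; congr EFin; field; rewrite gt_eqF.
- move=> x; apply: cvgM.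
    by apply: cvgB; [exact: cvg_cst|apply: cvgMl; exact: cvg_id].
  by apply: cvgM; [exact: cvg_id|exact: continuous_expRN].
Qed.

End improper_integrals.

(** * The gamma law of shape 2 *)

Section gamma2.
Context {R : realType}.
Local Notation leb := (@lebesgue_measure R).

(** Density of the sum of two independent standard exponential variables; the maximum extends it by
    0 to the negative half-line. *)
Definition gamma2_pdf (s : R) : R := Num.max s 0 * expR (- s).

Lemma gamma2_pdf_ge0 s : 0 <= gamma2_pdf s.
Proof. by rewrite mulr_ge0 ?expR_ge0// le_max lexx orbT. Qed.

Lemma gamma2_pdfE s : 0 <= s -> gamma2_pdf s = s * expR (- s).
Proof. by rewrite /gamma2_pdf => /max_idPl ->. Qed.

Lemma gamma2_pdf_eq0 s : s <= 0 -> gamma2_pdf s = 0.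
Proof. by rewrite /gamma2_pdf => /max_idPr ->; rewrite mul0r. Qed.

Lemma measurable_gamma2_pdf D : measurable_fun D gamma2_pdf.
Proof.
apply: measurable_funTS; apply: measurable_funM.
  exact: measurable_maxr.
by apply: measurableT_comp => //; exact: measurable_expR.
Qed.

Definition gamma2 (A : set (measurableTypeR R)) : \bar R :=
  (\int[leb]_(x in A) (gamma2_pdf x)%:E)%E.

Let gamma20 : gamma2 set0 = 0%E.
Proof. by rewrite /gamma2 integral_set0. Qed.

Let gamma2_ge0 A : (0 <= gamma2 A)%E.
Proof. by apply: integral_ge0 => x _; rewrite lee_fin gamma2_pdf_ge0. Qed.

Let gamma2_sigma_additive : semi_sigma_additive gamma2.
Proof.
move=> /= F mF tF mUF; rewrite /gamma2; apply: cvg_toP.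
  apply: ereal_nondecreasing_is_cvgn => m n mn.
  apply: lee_sum_nneg_natr => // k _ _; apply: integral_ge0 => /= x Fkx.
  by rewrite lee_fin gamma2_pdf_ge0.
rewrite ge0_integral_bigcup//=.
- apply/measurable_EFinP. exact: measurable_gamma2_pdf.
- by move=> x _; rewrite lee_fin gamma2_pdf_ge0.
Qed.

HB.instance Definition _ := isMeasure.Build _ _ _
  gamma2 gamma20 gamma2_ge0 gamma2_sigma_additive.

Lemma integral_mul_gamma2_pdf (f : R -> \bar R) :
  (\int[leb]_x (f x * (gamma2_pdf x)%:E) =
   \int[leb]_(x in `[0%R, +oo[) (f x * (x * expR (- x))%:E))%E.
Proof.
rewrite [RHS]integral_mkcond/=; apply: eq_integral => x _.
rewrite patchE; case: ifPn; rewrite ?inE ?notin_setE/= in_itv/= andbT.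
  by move=> x0; rewrite gamma2_pdfE.
by move=> /negP; rewrite -ltNge => /ltW x0; rewrite gamma2_pdf_eq0// mule0.
Qed.

Let gamma2_setT : gamma2 [set: measurableTypeR R] = 1%E.
Proof.
rewrite /gamma2; under eq_integral do rewrite -[_%:E]mul1e.
rewrite (integral_mul_gamma2_pdf (cst 1%E))/=.
under eq_integral do rewrite mul1e -{1}[X in (X * _)%R]subr0.
by rewrite integral_gamma_tail oppr0 expR0.
Qed.

HB.instance Definition _ :=
  @Measure_isProbability.Build _ _ R gamma2 gamma2_setT.

Let integral_gamma2_indic (E : set (measurableTypeR R)) : measurable E ->
  (\int[gamma2]_x (\1_E x)%:E = \int[leb]_x ((\1_E x)%:E * (gamma2_pdf x)%:E))%E.
Proof.
move=> mE; rewrite integral_indic//= setIT /gamma2 [LHS]integral_mkcond/=.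
apply: eq_integral => x _; rewrite patchE indicE.
by case: ifPn => _; rewrite ?mul1e ?mul0e.
Qed.

Import HBNNSimple.

Let integral_gamma2_nnsfun (f : {nnsfun (measurableTypeR R) >-> R}) :
  (\int[gamma2]_x (f x)%:E = \int[leb]_x ((f x)%:E * (gamma2_pdf x)%:E))%E.
Proof.
under [LHS]eq_integral do rewrite fimfunE -fsumEFin//.
rewrite [LHS]ge0_integral_fsum//; last 2 first.
  - by move=> r; exact/measurable_EFinP/measurableT_comp.
  - by move=> n x _; rewrite EFinM nnfun_muleindic_ge0.
under [RHS]eq_integral.
  move=> x xD; rewrite fimfunE -fsumEFin// muleC ge0_mule_fsumr; last first.
    by move=> r; rewrite EFinM nnfun_muleindic_ge0.
  over.
rewrite [RHS]ge0_integral_fsum//; last 2 first.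
  - move=> r; apply: emeasurable_funM.
      by apply/measurable_EFinP; exact: measurable_gamma2_pdf.
    by apply/measurable_EFinP; apply/measurableT_comp.
  - move=> n x _; rewrite EFinM mule_ge0//; last by rewrite nnfun_muleindic_ge0.
    by rewrite lee_fin gamma2_pdf_ge0.
apply: eq_fsbigr => r _.
(* A nonnegative simple function has an empty fibre over a negative value, so both terms vanish; a
   scalar [r >= 0] can be pulled out of the integrals. *)
have [r0|r0] := leP 0 r; last first.
  rewrite !integral0_eq// => x _.
    by rewrite preimage_nnfun0// indic0 mulr0 mule0.
  by rewrite preimage_nnfun0// indic0 mulr0.
under eq_integral do rewrite EFinM.
rewrite ge0_integralZl//; last exact/measurable_EFinP.
rewrite [RHS](eq_integral (fun x => r%:E *
    ((\1_(f @^-1` [set r]) x)%:E * (gamma2_pdf x)%:E)))%E; last first.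
  by move=> x _; rewrite -!EFinM; congr EFin; ring.
rewrite ge0_integralZl//; last 2 first.
  apply: emeasurable_funM; first exact/measurable_EFinP.
  by apply/measurable_EFinP; exact: measurable_gamma2_pdf.
  by move=> x _; rewrite mule_ge0// lee_fin gamma2_pdf_ge0.
by rewrite integral_gamma2_indic.
Qed.

(** The usual passage from indicators to simple functions, then to increasing limits by monotone
    convergence on both sides. *)
Lemma ge0_integral_gamma2 (f : measurableTypeR R -> \bar R) :
  measurable_fun setT f -> (forall x, 0 <= f x)%E ->
  (\int[gamma2]_x f x =
   \int[leb]_(x in `[0%R, +oo[) (f x * (x * expR (- x))%:E))%E.
Proof.
move=> mf f0; rewrite -integral_mul_gamma2_pdf.
pose f_ := nnsfun_approx measurableT mf.
transitivity (lim (\int[gamma2]_x (f_ n x)%:E @[n --> \oo])%E).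
  rewrite -monotone_convergence//=.
  - apply: eq_integral => ? /[!inE] xD; apply/esym/cvg_lim => //=.
    exact: cvg_nnsfun_approx.
  - by move=> n; exact/measurable_EFinP/measurable_funTS.
  - by move=> n ? _; rewrite lee_fin.
  - by move=> ? _ ? ? mn; rewrite lee_fin; exact/lefP/nd_nnsfun_approx.
rewrite [RHS](_ : _ = lim
    (\int[leb]_x ((f_ n x)%:E * (gamma2_pdf x)%:E) @[n --> \oo])%E); last first.
  rewrite -monotone_convergence//=.
  - apply: eq_integral => x _; apply/esym/cvg_lim => //.
    by apply: cvgeZr => //; exact: cvg_nnsfun_approx.
  - move=> n; apply: emeasurable_funM; first exact/measurable_EFinP.
    by apply/measurable_EFinP; exact: measurable_gamma2_pdf.
  - by move=> n x _; rewrite -EFinM lee_fin mulr_ge0// gamma2_pdf_ge0.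
  - move=> x _ m n mn; rewrite lee_wpmul2r ?lee_fin ?gamma2_pdf_ge0//.
    exact/lefP/nd_nnsfun_approx.
by apply: congr_lim; apply/funext => n /=; exact: integral_gamma2_nnsfun.
Qed.

End gamma2.

(** * The parameter-free score and its utility *)

Section reference_model.
Context {R : realType}.
Local Notation leb := (@lebesgue_measure R).
Local Notation plane := (measurableTypeR R * measurableTypeR R)%type.

Lemma uniform01_itvoo (p q : R) : 0 <= p -> q <= 1 -> p <= q ->
  uniform_prob (@ltr01 R) `]p, q[ = (q - p)%:E.
Proof.
move=> p0 q1 pq; rewrite /uniform_prob integral_uniform_pdf setIidl; last first.
  move=> t; rewrite /= !in_itv/= => /andP[pt tq].
  by rewrite (le_trans p0 (ltW pt)) (le_trans (ltW tq) q1).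
rewrite (eq_integral (cst 1%E)); last first.
  move=> t; rewrite inE/= in_itv/= => /andP[pt tq].
  by rewrite /uniform_pdf (le_trans p0 (ltW pt)) (le_trans (ltW tq) q1) subr0 invr1.
rewrite integral_cst//= mul1e lebesgue_measure_itv/= lte_fin.
by case: ltgtP pq => // -> _; rewrite subrr.
Qed.

Definition model : set plane -> \bar R := (gamma2 \x uniform_prob (@ltr01 R))%E.

HB.instance Definition _ := Probability.copy model (gamma2 \x uniform_prob (@ltr01 R))%E.

(** The integral over S is placed inside because it is the one computed in closed form; the integral
    over T remains in the final representation. *)
Lemma ge0_integral_model (f : plane -> \bar R) :
  measurable_fun setT f -> (forall z, 0 <= f z)%E ->
  (\int[model]_z f z =
   \int[leb]_(t in `[0%R, 1%R])
     \int[leb]_(s in `[0%R, +oo[) (f (s, t) * (s * expR (- s))%:E))%E.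
Proof.
move=> mf f0; rewrite fubini_tonelli2// integral_uniform//; last 2 first.
  exact: measurable_fun_fubini_tonelli_G.
  by move=> t; apply: integral_ge0.
rewrite subr0 invr1 mul1e; apply: eq_integral => t _.
by rewrite -ge0_integral_gamma2//; exact: measurableT_comp.
Qed.

Lemma measurable_section_integral (f : plane -> \bar R) :
  measurable_fun setT f -> (forall z, 0 <= f z)%E ->
  measurable_fun setT (fun t : measurableTypeR R =>
    \int[leb]_(s in `[0%R, +oo[) (f (s, t) * (s * expR (- s))%:E))%E.
Proof.
move=> mf f0; rewrite (_ : (fun _ => _) = fubini_G gamma2 f).
  exact: measurable_fun_fubini_tonelli_G.
apply/funext => t; rewrite /fubini_G ge0_integral_gamma2//.
exact: measurableT_comp.
Qed.

Lemma measurable_model_tail (a b : R) :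
  measurable [set z : plane | a < z.1 * z.2 /\ b < z.1 * (1 - z.2)].
Proof.
rewrite (_ : mkset _ = [set z : plane | a < z.1 * z.2] `&`
                       [set z : plane | b < z.1 * (1 - z.2)])//.
apply: measurableI; rewrite -[mkset _]setTI.
- rewrite (_ : mkset _ = (fun z : plane => a < z.1 * z.2) @^-1` [set true])//.
  by apply: measurable_fun_ltr => //; exact: measurable_funM.
- rewrite (_ : mkset _ = (fun z : plane => b < z.1 * (1 - z.2)) @^-1` [set true])//.
  apply: measurable_fun_ltr => //; apply: measurable_funM => //.
  exact: measurable_funB.
Qed.

(* This joint tail is that of two independent standard exponential variables,
   so no two-dimensional change of variables is needed to pass from the gaps to
   their sum and ratio. *)
Lemma model_tail (a b : R) : 0 <= a -> 0 <= b ->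
  model [set z | a < z.1 * z.2 /\ b < z.1 * (1 - z.2)] = (expR (- (a + b)))%:E.
Proof.
move=> a0 b0; set A := [set z | _].
have mA : measurable A := measurable_model_tail a b.
rewrite -integral_gamma_tail.
transitivity (\int[gamma2]_s uniform_prob (@ltr01 R) (xsection A s))%E => //.
rewrite ge0_integral_gamma2//; last exact: measurable_fun_xsection.
rewrite [LHS]integral_mkcond [RHS]integral_mkcond/=; apply: eq_integral => s _.
rewrite !patchE !mem_setE /= !in_itv/= !andbT.
have [s0|s0] := leP 0 s; last by rewrite leNgt (lt_le_trans s0)// addr_ge0.
have [->|sn0] := eqVneq s 0.
  rewrite mul0r mule0; case: ifPn => // ab0.
  by rewrite (_ : a + b = 0) ?subrr ?mul0r//; apply/eqP; rewrite eq_le ab0 addr_ge0.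
have {sn0} s0' : 0 < s by rewrite lt_neqAle eq_sym sn0.
have -> : xsection A s = `]a / s, 1 - b / s[%classic.
  apply/seteqP; split => t; rewrite /xsection/= in_itv/= inE /A/=.
    move=> [h1 h2]; rewrite ltr_pdivrMr// mulrC h1/=.
    by rewrite ltrBrDl -ltrBrDr ltr_pdivrMr// mulrC.
  rewrite ltr_pdivrMr// ltrBrDl -ltrBrDr ltr_pdivrMr// => /andP[h1 h2].
  by rewrite mulrC h1 mulrC.
have [abs|abs] := leP (a + b) s.
  rewrite uniform01_itvoo.
  - by rewrite -EFinM; congr EFin; field; rewrite gt_eqF.
  - by rewrite divr_ge0.
  - by rewrite gerBl divr_ge0.
  - by rewrite lerBrDr -mulrDl ler_pdivrMr// mul1r.
rewrite set_itv_ge ?measure0 ?mul0e// bnd_simp -leNgt.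
by rewrite lerBlDr -mulrDl ler_pdivlMr// mul1r ltW.
Qed.

End reference_model.

Lemma in_setb (T : Type) (p : T -> bool) (x : T) : (x \in [set y | p y]) = p x.
Proof. by apply/idP/idP; rewrite inE. Qed.

(** * The score: mean, censored mean and utility *)

Section score.
Context {R : realType}.
Local Notation leb := (@lebesgue_measure R).
Local Notation plane := (measurableTypeR R * measurableTypeR R)%type.

(* The maximum with 0 only matters on a null set; it makes [score] nonnegative
   everywhere, so that Tonelli's theorem applies. *)
Definition score (z : plane) : R := Num.max 0 (3 * (z.1 * (z.2 * (1 - z.2)))).

Lemma score_ge0 z : 0 <= score z.
Proof. by rewrite le_max lexx. Qed.

Lemma measurable_score : measurable_fun setT score.
Proof.
apply: measurable_maxr => //; do 3 apply: measurable_funM => //.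
exact: measurable_funB.
Qed.

Lemma score_itv (s t : R) : 0 <= s -> t \in `[0, 1] ->
  score (s, t) = 3 * (t * (1 - t)) * s.
Proof.
move=> s0; rewrite in_itv/= => /andP[t0 t1].
rewrite /score/= (elimT max_idPr); first by ring.
by rewrite !mulr_ge0// subr_ge0.
Qed.

(** The function H, with extended values until finiteness is derived from [integral_score]. *)
Definition censored_mean (r : R) : \bar R :=
  (\int[model]_z (score z * \1_[set z | score z < r] z)%:E)%E.

Definition mean_utility (r : R) : \bar R :=
  (\int[model]_z (Num.max (1 - score z / r) 0)%:E)%E.

Lemma measurable_score_lt r : measurable [set z | score z < r].
Proof.
rewrite (_ : mkset _ = (fun z => score z < r) @^-1` [set true])// -[_ @^-1` _]setTI.
by apply: measurable_fun_ltr => //; exact: measurable_score.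
Qed.

Lemma measurable_censored (r : R) :
  measurable_fun setT (fun z => score z * \1_[set z | score z < r] z).
Proof.
apply: measurable_funM; first exact: measurable_score.
by apply: measurable_indic; exact: measurable_score_lt.
Qed.

Lemma measurable_utility (r : R) :
  measurable_fun setT (fun z => Num.max (1 - score z / r) 0).
Proof.
apply: measurable_maxr => //; apply: measurable_funB => //.
by apply: measurable_funM => //; exact: measurable_score.
Qed.

Lemma integral_score : (\int[model]_z (score z)%:E = 1)%E.
Proof.
rewrite ge0_integral_model; last 2 first.
- by apply/measurable_EFinP; exact: measurable_score.
- by move=> z; rewrite lee_fin score_ge0.
rewrite (eq_integral (fun t : measurableTypeR R => (6 * (t * (1 - t)))%:E)); last first.
  move=> t; rewrite inE => /= t01.
  rewrite (eq_integral (fun s : measurableTypeR R => (3 * (t * (1 - t)))%:E *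
      (s * (s * expR (- s)))%:E))%E; last first.
    move=> s; rewrite inE/= in_itv/= andbT => s0.
    by rewrite score_itv// -!EFinM; congr EFin; ring.
  rewrite ge0_integralZl//=.
  - by rewrite integral_gamma_mean -EFinM; congr EFin; ring.
  - apply/measurable_EFinP; do 2 apply: measurable_funM => //.
    by apply: measurable_funTS; apply: measurableT_comp => //; exact: measurable_expR.
  - move=> s; rewrite in_itv/= andbT => s0.
    by rewrite lee_fin !mulr_ge0 ?expR_ge0.
  - move: t01; rewrite in_itv/= => /andP[t0 t1].
    by rewrite lee_fin !mulr_ge0 ?subr_ge0.
have dF (x : R) : is_derive x (1 : R) (fun t => 3 * t ^+ 2 - 2 * t ^+ 3)
    (6 * (x * (1 - x))).
  by apply: is_derive_eq; rewrite /GRing.scale/= ?expr1; ring.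
rewrite (integral_itv_bounded ltr01 _ dF).
  by congr EFin; ring.
move=> x; apply: cvgMr; apply: cvgM; first exact: cvg_id.
by apply: cvgB; [exact: cvg_cst|exact: cvg_id].
Qed.

Lemma mean_utilityE (r : R) : 0 < r ->
  mean_utility r = (\int[leb]_(t in `]0%R, 1%R[)
    (1 - 6 * t * (1 - t) / r
     + (1 + 6 * t * (1 - t) / r) * expR (- (r / (3 * t * (1 - t)))))%:E)%E.
Proof.
move=> r0; rewrite /mean_utility.
have mU : measurable_fun setT
    (fun z => (Num.max (1 - score z / r) 0)%:E).
  by apply/measurable_EFinP; exact: measurable_utility.
have U0 (z : plane) : (0 <= (Num.max (1 - score z / r) 0)%:E)%E.
  by rewrite lee_fin le_max lexx orbT.
rewrite ge0_integral_model//.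
pose F t := (\int[leb]_(s in `[0%R, +oo[)
  ((Num.max (1 - score (s, t) / r) 0)%:E * (s * expR (- s))%:E))%E.
have mF : measurable_fun setT F by exact: (measurable_section_integral mU U0).
rewrite -[LHS]/(\int[leb]_(t in `[0%R, 1%R]) F t)%E.
(* The endpoints are removed because the coefficient [c] of [s] in the score vanishes there, and [d]
   is a quotient by [c]. *)
rewrite -integral_itv_bndo_bndc; last exact: measurable_funTS.
rewrite -integral_itv_obnd_cbnd; last exact: measurable_funTS.
apply: eq_integral => t; rewrite inE/= => t01.
have t01' : t \in `[0, 1] by apply: subset_itv_oo_cc.
move: t01; rewrite in_itv/= => /andP[t0 t1].
pose c := 3 * (t * (1 - t)).
have c0 : 0 < c by rewrite !mulr_gt0// subr_gt0.
(* The value of [s] at which the score [c * s] reaches [r]; beyond it the positive part is 0. *)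
pose d := r / c.
have d0 : 0 < d by rewrite divr_gt0.
have -> : 3 * t * (1 - t) = c by rewrite /c; ring.
have -> : 6 * t * (1 - t) / r = 2 / d.
  by rewrite /d /c; field; rewrite !gt_eqF ?subr_gt0.
rewrite -/d -integral_gamma_positive_part//.
rewrite /F [LHS]integral_mkcond [RHS]integral_mkcond/=; apply: eq_integral => s _.
rewrite !patchE !mem_setE /= !in_itv/= andbT.
have [s0|//] := leP 0 s.
have E : score (s, t) / r = s / d.
  by rewrite score_itv// /d -/c; field; rewrite !gt_eqF.
rewrite E; have [sd|sd] := leP s d.
  rewrite (elimT max_idPl) ?EFinM//.
  by rewrite subr_ge0 ler_pdivrMr// mul1r.
rewrite (elimT max_idPr) ?mul0e//.
by rewrite subr_le0 ler_pdivlMr// mul1r ltW.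
Qed.

(* For fixed [t] the score is [c s] with [c = 3 t (1 - t)], and
   [c s * s exp (- s) <= 2 c] on an interval of length [(r' - r) / c]. *)
Lemma censored_mean_lip (r r' : R) : 0 < r -> r <= r' ->
  (censored_mean r' <= censored_mean r + (2 * (r' - r))%:E)%E.
Proof.
move=> r0 rr'.
pose D := [set z : plane | r <= score z] `&` [set z | score z < r'].
have mD : measurable D.
  apply: measurableI; last exact: measurable_score_lt.
  rewrite (_ : mkset _ = ~` [set z : plane | score z < r]).
    by apply: measurableC; exact: measurable_score_lt.
  by apply/seteqP; split => z /=; rewrite leNgt => /negP.
have mS : measurable_fun setT (fun z => (score z * \1_D z)%:E).
  apply/measurable_EFinP; apply: measurable_funM; first exact: measurable_score.
  exact: measurable_indic.
have S0 z : (0 <= (score z * \1_D z)%:E)%E by rewrite lee_fin mulr_ge0 ?score_ge0.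
have -> : censored_mean r' = (censored_mean r + \int[model]_z (score z * \1_D z)%:E)%E.
  rewrite -ge0_integralD//.
  - apply: eq_integral => z _; rewrite -EFinD -mulrDr; congr (_ * _)%:E.
    rewrite !indicE /D in_setI !in_setb.
    case: ltP => zr'; case: ltP => zr //=; rewrite ?addr0 ?add0r//.
    by have := lt_le_trans zr (le_trans rr' zr'); rewrite ltxx.
  - by move=> z _; rewrite lee_fin mulr_ge0 ?score_ge0.
  - by apply/measurable_EFinP; exact: measurable_censored.
apply: leeD => //; rewrite ge0_integral_model//.
apply: (@le_trans _ _ (\int[leb]_(t in `[0%R, 1%R]) (2 * (r' - r))%:E)%E); last first.
  by rewrite integral_cst//= lebesgue_measure_itv/= lte_fin ltr01 sube0 mule1.
apply: ge0_le_integral => //.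
- move=> t _; apply: integral_ge0 => s; rewrite /= in_itv/= andbT => s0.
  by rewrite mule_ge0// lee_fin mulr_ge0 ?expR_ge0.
- apply: measurable_funTS.
  exact: (measurable_section_integral mS S0).
move=> t /= t01; move: (t01); rewrite in_itv/= => /andP[t0 t1].
pose c := 3 * (t * (1 - t)).
have c0 : 0 <= c by rewrite !mulr_ge0// subr_ge0.
have [cE|cn0] := eqVneq c 0.
  rewrite integral0_eq; first by rewrite lee_fin mulr_ge0// subr_ge0.
  move=> s; rewrite /= in_itv/= andbT => s0.
  by rewrite score_itv// -/c cE !mul0r mul0e.
have {c0 cn0} c0 : 0 < c by rewrite lt_neqAle eq_sym cn0.
(* The bound is itself written as an integral over the values of [s] whose score lies between [r]
   and [r'], which reduces the claim to a pointwise comparison. *)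
rewrite (_ : (2 * (r' - r))%:E =
    \int[leb]_(s in `[(r / c)%R, (r' / c)%R]) (2 * c)%:E)%E; last first.
  rewrite integral_cst//= lebesgue_measure_itv/= lte_fin ltr_pM2r ?invr_gt0//.
  case: ltgtP rr' => // [rr' _|-> _]; last by rewrite subrr mulr0 mule0.
  by rewrite -EFinB -EFinM; congr EFin; field; rewrite gt_eqF.
rewrite integral_mkcond [leRHS]integral_mkcond; apply: ge0_le_integral => //.
- move=> s _; rewrite patchE mem_setE /= in_itv/= andbT; case: ifPn => // s0.
  by rewrite mule_ge0// lee_fin mulr_ge0 ?expR_ge0.
- apply/measurable_restrict => //; apply: measurable_funTS.
  apply: emeasurable_funM.
    by apply: (@measurableT_comp _ _ _ _ _ _ (fun z : plane => (score z * \1_D z)%:E)).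
  apply/measurable_EFinP; apply: measurable_funM => //.
  by apply: measurableT_comp => //; exact: measurable_expR.
- by apply/measurable_restrict.
move=> s _; rewrite !patchE !mem_setE /= !in_itv/= andbT.
have [s0|s0] := leP 0 s; last by case: ifPn => // _; rewrite lee_fin mulr_ge0// ltW.
rewrite indicE /D in_setI !in_setb score_itv// -/c.
have -> : (r / c <= s) = (r <= c * s) by rewrite ler_pdivrMr// mulrC.
have -> : (s <= r' / c) = (c * s <= r') by rewrite ler_pdivlMr// mulrC.
have K : (0 <= (if ((r <= c * s) && (c * s <= r'))%R then (2 * c)%:E else 0))%E.
  by case: ifPn => // _; rewrite lee_fin mulr_ge0// ltW.
have [h1|h1] /= := leP r (c * s); last by rewrite mulr0 mul0e.
have [h2|h2] := ltP (c * s) r'; last first.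
  by rewrite mulr0 mul0e; rewrite h1 in K.
rewrite (ltW h2) mulr1 -EFinM lee_fin.
rewrite -mulrA [leRHS]mulrC ler_pM2l//.
(* The constant 2 comes from 1 + s^2/2 <= exp s, that is, s^2 exp (-s) <= 2. *)
have := expR_ge1Dxn 1 s0; rewrite (_ : 2`!%:R = 2)// expRN => h.
rewrite mulrA ler_pdivrMr ?expR_gt0// -expr2; lra.
Qed.

End score.

(** A vanishing integral would make [f] zero almost everywhere, and [D] would lie in a null set. *)
Lemma ge0_integral_gt0 d (T : measurableType d) (R : realType)
    (m : {measure set T -> \bar R}) (f : T -> \bar R) (D : set T) :
  measurable_fun setT f -> (forall x, 0 <= f x)%E -> measurable D ->
  (0 < m D)%E -> (forall x, D x -> 0 < f x)%E -> (0 < \int[m]_x f x)%E.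
Proof.
move=> mf f0 mD mD0 fD; rewrite lt_neqAle integral_ge0// andbT eq_sym.
apply/negP => /eqP if0.
have : (\int[m]_x `|f x| = 0)%E.
  by rewrite -[RHS]if0; apply: eq_integral => x _; rewrite gee0_abs.
move=> /(ae_eq_integral_abs _ measurableT mf)[N [mN N0 fN]].
suff : (m D <= m N)%E by rewrite N0 leNgt mD0.
apply: le_measure; rewrite ?inE// => x Dx; apply: fN => /=.
by move=> /(_ I) fx; have := fD x Dx; rewrite fx ltxx.
Qed.

(** * Differentiability from two-sided slope bounds *)

Section sandwich.
Context {R : realType}.
Variables u h : R -> R.
Hypothesis u_lower : forall r s, 0 < r -> r < s ->
  u r + (r^-1 - s^-1) * h r <= u s.
Hypothesis u_upper : forall r s, 0 < r -> r < s ->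
  u s <= u r + (r^-1 - s^-1) * h s.
Hypothesis h_lip : forall r s, 0 < r -> r < s -> h s <= h r + 2 * (s - r).

(** On either side of [r] the error is nonnegative and at most |1/r - 1/y| times the increase of [h]
    from the smaller to the larger point, which [h_lip] bounds by 2|y - r|. *)
Let error_bound r y : 0 < r -> 0 < y -> y != r ->
  `|u y - u r - (r^-1 - y^-1) * h r| <= 2 * (y - r) ^+ 2 / (r * y).
Proof.
move=> r0 y0; have -> : 2 * (y - r) ^+ 2 / (r * y) =
    2 * (y - r) * (r^-1 - y^-1).
  by field; rewrite !gt_eqF.
rewrite neq_lt => /orP[yr|ry].
  have k0 : 0 < y^-1 - r^-1 by rewrite subr_gt0 ltf_pV2.
  have hl := u_lower y0 yr; have hu := u_upper y0 yr; have hh := h_lip y0 yr.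
  have : (y^-1 - r^-1) * h r <= (y^-1 - r^-1) * (h y + 2 * (r - y)).
    by rewrite ler_pM2l.
  by move=> ?; rewrite ler_norml; apply/andP; split; nra.
have k0 : 0 < r^-1 - y^-1 by rewrite subr_gt0 ltf_pV2.
have hl := u_lower r0 ry; have hu := u_upper r0 ry; have hh := h_lip r0 ry.
have : (r^-1 - y^-1) * h y <= (r^-1 - y^-1) * (h r + 2 * (y - r)).
  by rewrite ler_pM2l.
by move=> ?; rewrite ler_norml; apply/andP; split; nra.
Qed.

Lemma is_derive_sandwich (r : R) : 0 < r ->
  is_derive r (1 : R) u (h r / r ^+ 2).
Proof.
move=> r0.
suff C : x^-1 *: (u (x *: (1 : R) + r) - u r) @[x --> 0^'] --> h r / r ^+ 2.
  apply: DeriveDef; first by apply/cvg_ex; exists (h r / r ^+ 2).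
  exact: cvg_lim C.
apply/cvgrPdist_le => e e0.
(* Put y = x + r, with y > r/2. The error bound divided by |x| is 2|x|/(ry) <= 4|x|/r^2. Since (1/r
   - 1/y)/x = 1/(ry), replacing this slope by 1/r^2 costs |x||h r|/(r^2 y) <= 2|x||h r|/r^3. *)
pose M := 4 / r ^+ 2 + 2 * `|h r| / r ^+ 3.
have M0 : 0 < M.
  rewrite ltr_pwDl//; first by rewrite divr_gt0 ?exprn_gt0.
  by rewrite divr_ge0 ?exprn_ge0 ?(ltW r0)// mulr_ge0.
near=> x.
have x0 : x != 0 by near: x; exact: nbhs_dnbhs_neq.
have xr : `|x| < r / 2.
  by near: x; apply: dnbhs0_lt; rewrite divr_gt0.
have xe : `|x| <= e / M.
  by near: x; apply: dnbhs0_le; rewrite divr_gt0.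
have y0 : r / 2 < x + r by move: xr; rewrite ltr_norml => /andP[]; lra.
have y00 : 0 < x + r by rewrite (lt_trans _ y0) ?divr_gt0.
have yr : x + r != r by rewrite -subr_eq0 addrK.
rewrite /GRing.scale/= mulr1.
have B := error_bound r0 y00 yr.
have -> : h r / r ^+ 2 - x^-1 * (u (x + r) - u r) =
    - (x^-1 * (u (x + r) - u r - (r^-1 - (x + r)^-1) * h r))
    + x * h r / (r ^+ 2 * (x + r)).
  by field; rewrite x0 !gt_eqF.
rewrite (le_trans (ler_normD _ _))// normrN normrM normfV.
apply: (@le_trans _ _ (`|x| * M)); last by rewrite -ler_pdivlMr.
have iy : (x + r)^-1 <= 2 / r.
  by rewrite -[2 / r]invf_div lef_pV2 ?posrE ?divr_gt0// ltW.
have iy0 : 0 <= (x + r)^-1 by rewrite invr_ge0 ltW.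
rewrite /M [leRHS]mulrDr lerD//.
  rewrite ler_pdivrMl ?normr_gt0// (le_trans B)// addrK -(real_normK (num_real x)).
  rewrite [leLHS](_ : _ = `|x| ^+ 2 * (2 / r) * (x + r)^-1); last first.
    by field; rewrite !gt_eqF.
  rewrite [leRHS](_ : _ = `|x| ^+ 2 * (2 / r) * (2 / r)); last first.
    by field; rewrite gt_eqF.
  by rewrite ler_wpM2l// mulr_ge0 ?exprn_ge0 ?divr_ge0// ltW.
rewrite normrM normfV normrM.
rewrite (@ger0_norm _ (r ^+ 2 * (x + r))); last first.
  by rewrite mulr_ge0 ?exprn_ge0 ?(ltW r0) ?(ltW y00).
rewrite [leLHS](_ : _ = `|x| * `|h r| / r ^+ 2 * (x + r)^-1); last first.
  by field; rewrite !gt_eqF.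
rewrite [leRHS](_ : _ = `|x| * `|h r| / r ^+ 2 * (2 / r)); last first.
  by field; rewrite gt_eqF.
by rewrite ler_wpM2l// divr_ge0 ?exprn_ge0 ?(ltW r0)// mulr_ge0.
Unshelve. all: by end_near. Qed.

End sandwich.

(** * Monotonicity, positivity and derivative of the utility *)

Section utility.
Context {R : realType}.
Local Notation plane := (measurableTypeR R * measurableTypeR R)%type.

Let censored_ge0 (r : R) (z : plane) :
  (0 <= (score z * \1_[set z | (score z < r)%R] z)%:E)%E.
Proof. by rewrite lee_fin mulr_ge0 ?score_ge0. Qed.

Let util_ge0 (r : R) (z : plane) : (0 <= (Num.max (1 - score z / r) 0)%:E)%E.
Proof. by rewrite lee_fin le_max lexx orbT. Qed.

Let mcensored (r : R) :
  measurable_fun setT (fun z => (score z * \1_[set z | score z < r] z)%:E).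
Proof. by apply/measurable_EFinP; exact: measurable_censored. Qed.

Let mutil (r : R) :
  measurable_fun setT (fun z => (Num.max (1 - score z / r) 0)%:E).
Proof. by apply/measurable_EFinP; exact: measurable_utility. Qed.

Lemma censored_mean_fin_num (r : R) : censored_mean r \is a fin_num.
Proof.
rewrite ge0_fin_numE ?integral_ge0// (le_lt_trans _ (ltry 1))//.
rewrite -integral_score; apply: ge0_le_integral => //.
  by apply/measurable_EFinP; exact: measurable_score.
by move=> z _; rewrite lee_fin ler_piMr ?score_ge0.
Qed.

Lemma mean_utility_fin_num (r : R) : 0 < r -> mean_utility r \is a fin_num.
Proof.
move=> r0; rewrite ge0_fin_numE ?integral_ge0// (le_lt_trans _ (ltry 1))//.
rewrite -(@probability_setT _ _ _ (@model R)) -[leRHS]mul1e -integral_cst//.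
apply: ge0_le_integral => // z _.
by rewrite lee_fin ge_max ler01 gerBl divr_ge0 ?score_ge0// ltW.
Qed.

Definition utility (r : R) : R := fine (mean_utility r).

Definition censored (r : R) : R := fine (censored_mean r).

Lemma censoredE (r : R) : (censored r)%:E = censored_mean r.
Proof. by rewrite fineK// censored_mean_fin_num. Qed.

Lemma utilityE (r : R) : 0 < r -> (utility r)%:E = mean_utility r.
Proof. by move=> r0; rewrite fineK// mean_utility_fin_num. Qed.

Let slope_ge0 (r s : R) : 0 < r -> r < s -> 0 <= r^-1 - s^-1.
Proof. by move=> r0 rs; rewrite subr_ge0 lef_pV2 ?posrE ?(lt_trans r0 rs)// ltW. Qed.

(** As a function of x = 1/r, (1 - Vx)_+ is convex with subgradient -V 1{V < r}. This is the
    integrated subgradient inequality at 1/r; [utility_upper] is the one at 1/s. *)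
Lemma utility_lower (r s : R) : 0 < r -> r < s ->
  utility r + (r^-1 - s^-1) * censored r <= utility s.
Proof.
move=> r0 rs; have s0 := lt_trans r0 rs; have k0 := slope_ge0 r0 rs.
rewrite -lee_fin EFinD EFinM censoredE !utilityE//.
rewrite -ge0_integralZl// -ge0_integralD//; last 2 first.
  by move=> z _; rewrite mule_ge0.
  by apply: measurable_funeM.
apply: ge0_le_integral => //.
- by move=> z _; rewrite adde_ge0// mule_ge0.
- by apply: emeasurable_funD => //; apply: measurable_funeM.
move=> z _; rewrite -EFinM -EFinD lee_fin indicE in_setb.
have [zr|rz] := ltP (score z) r.
  rewrite (elimT max_idPl) ?subr_ge0 ?ler_pdivrMr ?mul1r ?(ltW zr)//.
  by rewrite mulr1 le_max; apply/orP; left; lra.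
rewrite (elimT max_idPr); first by rewrite mulr0 mulr0 addr0 le_max lexx orbT.
by rewrite subr_le0 ler_pdivlMr// mul1r.
Qed.

Lemma utility_upper (r s : R) : 0 < r -> r < s ->
  utility s <= utility r + (r^-1 - s^-1) * censored s.
Proof.
move=> r0 rs; have s0 := lt_trans r0 rs; have k0 := slope_ge0 r0 rs.
rewrite -lee_fin EFinD EFinM censoredE !utilityE//.
rewrite -ge0_integralZl// -ge0_integralD//; last 2 first.
  by move=> z _; rewrite mule_ge0.
  by apply: measurable_funeM.
apply: ge0_le_integral => //.
  by apply: emeasurable_funD => //; apply: measurable_funeM.
move=> z _; rewrite -EFinM -EFinD lee_fin indicE in_setb.
have [zs|sz] := ltP (score z) s.
  rewrite ge_max mulr1 addr_ge0 ?mulr_ge0 ?score_ge0 ?le_max ?lexx ?orbT// andbT.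
  have : 1 - score z / r <= Num.max (1 - score z / r) 0 by rewrite le_max lexx.
  by lra.
rewrite (elimT max_idPr); first by rewrite mulr0 mulr0 addr0 le_max lexx orbT.
by rewrite subr_le0 ler_pdivlMr// mul1r.
Qed.

Lemma censored_lip (r s : R) : 0 < r -> r < s ->
  censored s <= censored r + 2 * (s - r).
Proof.
move=> r0 rs; rewrite -lee_fin EFinD !censoredE.
by apply: censored_mean_lip => //; exact: ltW.
Qed.

Lemma is_derive_utility (r : R) : 0 < r ->
  is_derive r (1 : R) utility (censored r / r ^+ 2).
Proof.
exact: is_derive_sandwich utility_lower utility_upper censored_lip r.
Qed.

Let measurable_tail (a b : R) :
  measurable [set z : plane | a < z.1 * z.2 /\ b < z.1 * (1 - z.2)].
Proof. exact: measurable_model_tail. Qed.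

(* The score is 3/2 times the harmonic mean of [z.1 * z.2] and
   [z.1 * (1 - z.2)]. *)
Lemma score_tail_ge (x : R) (z : plane) : 0 < x ->
  2 * x < z.1 * z.2 -> 2 * x < z.1 * (1 - z.2) -> 3 * x <= score z.
Proof.
case: z => s t /= x0 h1 h2; rewrite le_max /=; apply/orP; right.
have s0 : 0 < s by nra.
rewrite ler_pM2l// -(ler_pM2l s0).
by nra.
Qed.

(** The score is less than three times the left scaled gap, so it lies strictly between 0 and [r]
    when both gaps are positive and the left one is at most r/4. By [model_tail] this region has
    mass 1 - exp (-r/4). *)
Lemma censored_gt0 (r : R) : 0 < r -> 0 < censored r.
Proof.
move=> r0; rewrite -lte_fin censoredE.
pose A0 := [set z : plane | 0 < z.1 * z.2 /\ 0 < z.1 * (1 - z.2)].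
pose A1 := [set z : plane | r / 4 < z.1 * z.2 /\ 0 < z.1 * (1 - z.2)].
have mA0 : measurable A0 by exact: measurable_tail.
have mA1 : measurable A1 by exact: measurable_tail.
have r4 : 0 < r / 4 by rewrite divr_gt0.
apply: (@ge0_integral_gt0 _ _ _ _ _ (A0 `\` A1)) => //.
- exact: measurableD.
- rewrite measureD//; last by rewrite ltey_eq fin_num_measure.
  rewrite (_ : A0 `&` A1 = A1); last first.
    apply: setIidr => z [z1 z2]; split => //; exact: lt_trans z1.
  change (0 < model A0 - model A1)%E.
  rewrite /A0 /A1 !model_tail ?lexx ?(ltW r4)// !addr0 oppr0 expR0.
  rewrite -EFinB lte_fin subr_gt0.
  by rewrite expR_lt1 oppr_lt0.
move=> z [[z1 z2] /= zA1]; rewrite lte_fin indicE in_setb.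
have z3 : z.1 * z.2 <= r / 4 by rewrite leNgt; apply/negP => h; apply: zA1.
have s0 : 0 < z.1 by nra.
have z0 : 0 < z.2 by rewrite -(pmulr_rgt0 _ s0).
have z10 : 0 < 1 - z.2 by rewrite -(pmulr_rgt0 _ s0).
have sc : score z = 3 * (z.1 * (z.2 * (1 - z.2))).
  by rewrite /score (elimT max_idPr)// !mulr_ge0// ltW.
have -> : score z < r by rewrite sc; nra.
by rewrite mulr1 sc !mulr_gt0.
Qed.

(** What is missing from the mean 1 is E[V; V >= r]. It is positive because V >= r as soon as both
    scaled gaps exceed 2r/3, an event of mass exp (-4r/3). *)
Lemma censored_lt1 (r : R) : 0 < r -> censored r < 1.
Proof.
move=> r0; rewrite -lte_fin censoredE -integral_score.
pose C := fun z : plane => (score z * \1_(~` [set z | score z < r]) z)%:E.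
have C0 z : (0 <= C z)%E by rewrite lee_fin mulr_ge0 ?score_ge0.
have mC : measurable_fun setT C.
  apply/measurable_EFinP; apply: measurable_funM; first exact: measurable_score.
  apply: measurable_indic; apply: measurableC; exact: measurable_score_lt.
rewrite (_ : (\int[model]_z _ = censored_mean r + \int[model]_z C z)%E); last first.
  rewrite -ge0_integralD//; apply: eq_integral => z _.
  rewrite -EFinD -mulrDr !indicE in_setC in_setb.
  by case: (_ < _); rewrite ?addr0 ?add0r mulr1.
rewrite -[ltLHS]adde0 lteD2lE ?censored_mean_fin_num//.
apply: (@ge0_integral_gt0 _ _ _ _ _
  [set z : plane | 2 * (r / 3) < z.1 * z.2 /\ 2 * (r / 3) < z.1 * (1 - z.2)]) => //.
  have r30 : 0 <= 2 * (r / 3) by rewrite mulr_ge0// divr_ge0// ltW.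
  by have := model_tail r30 r30; rewrite /= => ->; rewrite lte_fin expR_gt0.
move=> z [z1 z2]; have r3 : 0 < r / 3 by rewrite divr_gt0.
have sc := score_tail_ge r3 z1 z2.
have rz : r <= score z by lra.
by rewrite lte_fin indicE in_setC in_setb [score z < r]ltNge rz mulr1 (lt_le_trans r0).
Qed.

Lemma utility_increasing (r s : R) : 0 < r -> r < s -> utility r < utility s.
Proof.
move=> r0 rs; apply: lt_le_trans (utility_lower r0 rs).
by rewrite ltrDl mulr_gt0 ?censored_gt0// subr_gt0 ltf_pV2 ?posrE// (lt_trans r0).
Qed.

(** Nonnegativity at r/2 and strict monotonicity. *)
Lemma utility_gt0 (r : R) : 0 < r -> 0 < utility r.
Proof.
move=> r0; have h0 : 0 < r / 2 by rewrite divr_gt0.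
apply: le_lt_trans (@utility_increasing (r / 2) r h0 _); last first.
  by rewrite ltr_pdivrMr// ltr_pMr// ltr1n.
by rewrite fine_ge0// integral_ge0.
Qed.

End utility.

(** * Void probabilities seen from the task *)

Section misses.
Context {R : realType}.
Implicit Types (S : set R) (c d x : R).

Lemma bounded_itvcc c d : bounded_set `[c, d]%classic.
Proof. by apply: compact_bounded; exact: segment_compact. Qed.

Definition locally_finite S : Prop :=
  forall B : set R, bounded_set B -> finite_set (S `&` B).

Definition misses S c d : Prop := forall y, S y -> ~~ (c <= y <= d).

Lemma misses_sub S c d c' d' : c <= c' -> d' <= d ->
  misses S c d -> misses S c' d'.
Proof.
move=> cc' dd' m y /m; apply: contra => /andP[cy yd].
by rewrite (le_trans cc' cy) (le_trans yd dd').
Qed.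

(** Finitely many points lie within distance 1 of the interval, each at a positive distance from it.
    The slack gives the strict inequalities for [sup] and [inf] and later absorbs the dyadic
    rounding. *)
Lemma misses_wider S c d : locally_finite S -> misses S c d ->
  exists2 e, 0 < e & misses S (c - e) (d + e).
Proof.
move=> fS m.
have /finite_seqP[s sE] : finite_set (S `&` `[c - 1, d + 1]%classic).
  by apply: fS; exact: bounded_itvcc.
(* The bound [e <= 1] keeps the widened interval inside the window where the points are listed; half
   the distance to each outside point keeps it out of the closed interval. *)
have [e /andP[e0 e1] es] : exists2 e, 0 < e <= 1 &
    forall y, y \in s -> ~~ (c <= y <= d) -> ~~ (c - e <= y <= d + e).
  elim: s {sE} => [|z s [e /andP[e0 e1] es]]; first by exists 1; rewrite // ltr01 lexx.
  have [f /andP[f0 f1] zf] : exists2 f, 0 < f <= 1 &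
      (~~ (c <= z <= d) -> ~~ (c - f <= z <= d + f)).
    have [|nz] := boolP (c <= z <= d); first by exists 1; rewrite ?ltr01 ?lexx.
    have [cz|zc] := leP c z; last first.
      exists (Num.min 1 ((c - z) / 2)).
        by rewrite lt_min ge_min lexx ltr01 andbT/=; lra.
      move=> _; apply/negP => /andP[h _].
      have : Num.min 1 ((c - z) / 2) <= (c - z) / 2 by rewrite ge_min lexx orbT.
      lra.
    have [zd|dz] := leP z d; first by rewrite cz zd in nz.
    exists (Num.min 1 ((z - d) / 2)).
      by rewrite lt_min ge_min lexx ltr01 andbT/=; lra.
    move=> _; apply/negP => /andP[_ h].
    have : Num.min 1 ((z - d) / 2) <= (z - d) / 2 by rewrite ge_min lexx orbT.
    lra.
  have le_e : Num.min e f <= e by rewrite ge_min lexx.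
  have le_f : Num.min e f <= f by rewrite ge_min lexx orbT.
  exists (Num.min e f); first by rewrite lt_min e0 f0 (le_trans le_e e1).
  move=> y; rewrite inE => /orP[/eqP ->|ys] ny.
    by apply: contra (zf ny) => /andP[? ?]; apply/andP; split; lra.
  by apply: contra (es _ ys ny) => /andP[? ?]; apply/andP; split; lra.
exists e => // y Sy; have [yE|] := boolP (y \in s); first by apply: es => //; exact: m.
apply: contra => yI; have : [set` s] y; last by [].
rewrite -sE; split => //=; rewrite in_itv/=.
by move: yI => /andP[? ?]; apply/andP; split; lra.
Qed.

(** The existence of a point on the left excludes the default value of [sup] on the empty set.
    Widening the missed interval bounds the supremum strictly below [x - a]. *)
Lemma left_gap_gt S x a : locally_finite S -> (exists2 y, S y & y <= x) ->
  0 <= a -> (a < x - left_point S x) <-> misses S (x - a) x.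
Proof.
move=> fS [y0 Sy0 y0x] a0; rewrite /left_point; set L := [set y | _].
have uL : has_ubound L by exists x => y [].
split=> [aL y Sy|/(misses_wider fS)[e e0 m]].
  apply/negP => /andP[xy yx].
  have : y <= sup L by apply: ub_le_sup.
  lra.
suff : sup L <= x - a - e by lra.
apply: ge_sup; first by exists y0.
move=> y [Sy yx]; rewrite leNgt; apply/negP => ye.
by have /negP := m y Sy; apply; apply/andP; split; lra.
Qed.

Lemma right_gap_gt S x b : locally_finite S -> (exists2 y, S y & x <= y) ->
  0 <= b -> (b < right_point S x - x) <-> misses S x (x + b).
Proof.
move=> fS [y0 Sy0 y0x] a0; rewrite /right_point; set L := [set y | _].
have uL : has_lbound L by exists x => y [].
split=> [aL y Sy|/(misses_wider fS)[e e0 m]].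
  apply/negP => /andP[xy yx].
  have : inf L <= y by apply: ge_inf.
  lra.
suff : x + b + e <= inf L by lra.
apply: lb_le_inf; first by exists y0.
move=> y [Sy yx]; rewrite leNgt; apply/negP => ye.
by have /negP := m y Sy; apply; apply/andP; split; lra.
Qed.

Lemma misses_split S x a b : 0 <= a -> 0 <= b ->
  misses S (x - a) (x + b) <-> misses S (x - a) x /\ misses S x (x + b).
Proof.
move=> a0 b0; split=> [m|[m1 m2] y Sy].
  by split; apply: misses_sub m; rewrite ?lerDl ?gerBl.
have [yx|/ltW xy] := leP y x.
  by apply: contra (m1 y Sy) => /andP[-> _].
by apply: contra (m2 y Sy) => /andP[_ ->]; rewrite xy.
Qed.

End misses.

Section dyadic.
Context {R : realType}.

Definition dyadic (n : nat) (x : R) : R := (Num.floor (x * 2 ^+ n))%:~R / 2 ^+ n.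

Let pow_gt0 n : 0 < 2 ^+ n :> R. Proof. by rewrite exprn_gt0. Qed.

Lemma dyadic_le n x : dyadic n x <= x.
Proof. by rewrite ler_pdivrMr// floor_le. Qed.

Lemma dyadic_gt n x : x < dyadic n x + (2 ^+ n)^-1.
Proof.
rewrite /dyadic -[X in _ + X]mul1r -mulrDl ltr_pdivlMr//.
by have := floorD1_gt (x * 2 ^+ n); rewrite intrD.
Qed.

(** From 2 floor(y) <= floor(2y). With the companion bound on right endpoints in [dyadic_ni], the
    cells containing [x] are nested, so the rounded void events increase with [n]. *)
Lemma dyadic_nd n x : dyadic n x <= dyadic n.+1 x.
Proof.
have : Num.floor (x * 2 ^+ n) * 2 <= Num.floor (x * 2 ^+ n.+1).
  by rewrite floor_ge_int intrM exprSr mulrA ler_pM2r// floor_le.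
rewrite -(ler_int R) intrM => h.
rewrite /dyadic [leLHS](_ : _ =
    (Num.floor (x * 2 ^+ n))%:~R * 2 / 2 ^+ n.+1); last first.
  by rewrite exprS; field; rewrite gt_eqF.
by rewrite ler_pM2r ?invr_gt0.
Qed.

Lemma dyadic_ni n x :
  dyadic n.+1 x + (2 ^+ n.+1)^-1 <= dyadic n x + (2 ^+ n)^-1.
Proof.
have : Num.floor (x * 2 ^+ n.+1) + 1 <= (Num.floor (x * 2 ^+ n) + 1) * 2.
  by rewrite lezD1 floor_lt_int intrM exprSr mulrA ltr_pM2r// floorD1_gt.
rewrite -(ler_int R) intrM !intrD => h.
rewrite /dyadic [leLHS](_ : _ =
    ((Num.floor (x * 2 ^+ n.+1))%:~R + 1) / 2 ^+ n.+1); last first.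
  by rewrite mulrDl mul1r.
rewrite [leRHS](_ : _ =
    ((Num.floor (x * 2 ^+ n))%:~R + 1) * 2 / 2 ^+ n.+1); last first.
  by rewrite exprS; field; rewrite gt_eqF.
by rewrite ler_pM2r ?invr_gt0.
Qed.

End dyadic.

(** Total probability over the values of [J], with the same conditional probability [c] on every
    fibre. Measurability of [E] is a conclusion, since [E] is the countable union of its traces. *)
Lemma probability_fibers d (T : measurableType d) (R : realType)
    (P : probability T R) (J : T -> nat) (E : set T) (c : R) : 0 <= c ->
  (forall n, measurable (J @^-1` [set n])) ->
  (forall n, measurable (E `&` J @^-1` [set n])) ->
  (forall n, P (E `&` J @^-1` [set n]) = c%:E * P (J @^-1` [set n]))%E ->
  measurable E /\ P E = c%:E.
Proof.
move=> c0 mJ mE PE.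
have JT : \bigcup_n (J @^-1` [set n]) = setT.
  by apply/seteqP; split => // x _; exists (J x).
have EE : E = \bigcup_n (E `&` J @^-1` [set n]) by rewrite -setI_bigcupr JT setIT.
split; first by rewrite EE; exact: bigcupT_measurable.
have tJ : trivIset setT (fun n => J @^-1` [set n]).
  by move=> i j _ _ [x [/= <- <-]].
rewrite [in LHS]EE measure_semi_bigcup//; last first.
- by rewrite -EE EE; exact: bigcupT_measurable.
- by move=> i j _ _ [x [[_ /= <-] [_ /= <-]]].
rewrite (eq_eseriesr (fun n _ => PE n)) nneseriesZl//.
have := @measure_semi_bigcup _ _ _ P _ mJ tJ (bigcupT_measurable _ mJ).
rewrite JT => <-; rewrite -[RHS]mule1; congr (_ * _)%E; exact: probability_setT.
Qed.

Section gaps.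
Context {R : realType} {d : measure_display} {Om : measurableType d}.
Variables (P : probability Om R) (lam : R) (K : Om -> set R) (X : {RV P >-> R}).
Hypothesis lam0 : 0 < lam.
Hypothesis BP : brownian_poisson_baseline lam K X.

Lemma points_locally_finite w : locally_finite (K w).
Proof. by move=> B; apply: (poisson_locally_finite (baseline_points BP) w). Qed.

Let missesE (p q : R) :
  [set w | misses (K w) p q] = count_event K `[p, q]%classic 0.
Proof.
apply/seteqP; split => w /=; rewrite /count_event/= II0 card_eq0.
  move=> m; apply/eqP/seteqP; split => // y [Ky]; rewrite /= in_itv/= => ypq.
  by have := m y Ky; rewrite ypq.
move=> /eqP m y Ky; apply/negP => ypq.
have : (K w `&` `[p, q]) y by split; rewrite /= ?in_itv.
by rewrite m.
Qed.

Let misses_measurable (p q : R) : measurable [set w | misses (K w) p q].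
Proof.
rewrite missesE; apply: (poisson_measurable (baseline_points BP)) => //.
exact: bounded_itvcc.
Qed.

Let misses_task (p q : R) (A : set R) : p < q -> measurable A ->
  P ([set w | misses (K w) p q] `&` X @^-1` A) =
  ((expR (- (lam * (q - p))))%:E * P (X @^-1` A))%E.
Proof.
move=> pq mA; have bI := @bounded_itvcc R p q.
rewrite missesE (baseline_indep BP)//; last first.
  by apply: sub_sigma_algebra; exists `[p, q]%classic, 0%N.
congr (_ * _)%E; rewrite (poisson_law (baseline_points BP))//.
rewrite lebesgue_measure_itv/= lte_fin pq -EFinB/= /poisson_prob.
have rate0 : 0 < lam * (q - p) by rewrite mulr_gt0// subr_gt0.
rewrite rate0 esum_set1; last by rewrite lee_fin poisson_pmf_ge0.
by rewrite /poisson_pmf rate0 expr0 fact0 invr1 !mul1r.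
Qed.

Definition void_event (a b : R) : set Om :=
  [set w | misses (K w) (X w - a) (X w + b)].

(* Replacing the task by the dyadic cell containing it leaves countably many
   cases, in each of which the void interval is deterministic. *)
Let dyadic_void (a b : R) (n : nat) : set Om :=
  [set w | misses (K w) (dyadic n (X w) - a) (dyadic n (X w) + (2 ^+ n)^-1 + b)].

Let measurable_floor (n : nat) (k : int) :
  measurable [set x : R | Num.floor (x * 2 ^+ n) = k].
Proof.
rewrite (_ : mkset _ = `[k%:~R / 2 ^+ n, (k + 1)%:~R / 2 ^+ n[%classic)//.
apply/seteqP; split => x /=; rewrite in_itv/= ler_pdivrMr ?ltr_pdivlMr ?exprn_gt0//.
  by move/eqP; rewrite floor_eq.
by move=> h; apply/eqP; rewrite floor_eq.
Qed.

Let dyadic_voidP (a b : R) (n : nat) : 0 <= a -> 0 <= b ->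
  measurable (dyadic_void a b n) /\
  P (dyadic_void a b n) = (expR (- (lam * (a + b + (2 ^+ n)^-1))))%:E.
Proof.
(* The integer index of the cell is coded as a natural number to fit [probability_fibers]; naturals
   that code no integer give empty fibres. *)
move=> a0 b0; pose J w := pickle (Num.floor (X w * 2 ^+ n)).
pose A k := [set x : R | Num.floor (x * 2 ^+ n) = k].
have JE m : (exists2 k, J @^-1` [set m] = X @^-1` A k &
      dyadic_void a b n `&` J @^-1` [set m] =
      [set w | misses (K w) (k%:~R / 2 ^+ n - a) (k%:~R / 2 ^+ n + (2 ^+ n)^-1 + b)]
        `&` X @^-1` A k)
    \/ J @^-1` [set m] = set0.
  have [[k km]|no] := pselect (exists k : int, pickle k = m); [left|right].
    exists k.
      apply/seteqP; split => w /=; rewrite /J -km; first by move/(pcan_inj pickleK).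
      by rewrite /A/= => ->.
    apply/seteqP; split => w /=; rewrite /dyadic_void /A /J -km/= /dyadic.
      by move=> [h /(pcan_inj pickleK) <-].
    by move=> [h kE]; rewrite kE.
  apply/seteqP; split => w //= Jw; apply: no; exists (Num.floor (X w * 2 ^+ n)).
  exact: Jw.
have mX k : measurable (X @^-1` A k).
  by rewrite -[_ @^-1` _]setTI; exact: (measurable_funPT X _ _ (measurable_floor n k)).
apply: (@probability_fibers _ _ _ _ J).
- exact: expR_ge0.
- by move=> m; have [[k -> _]|->] := JE m.
- move=> m; have [[k _ ->]|->] := JE m; last by rewrite setI0.
  exact: measurableI.
- move=> m; have [[k -> ->]|->] := JE m; last by rewrite setI0 measure0 mule0.
  have n0 : 0 < (2 ^+ n)^-1 :> R by rewrite invr_gt0 exprn_gt0.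
  rewrite misses_task//; last exact: measurable_floor; last by lra.
  by congr (_%:E * _)%E; congr (expR (- (_ * _))); ring.
Qed.

Let dyadic_void_nd (a b : R) : nondecreasing_seq (dyadic_void a b).
Proof.
apply/nondecreasing_seqP => n; apply/subsetPset => w; apply: misses_sub.
  by rewrite lerD2r dyadic_nd.
by rewrite lerD2r dyadic_ni.
Qed.

(** A rounded interval contains the true one, and exceeds it by at most 2^-n on each side; once 2^-n
    is below the slack of [misses_wider] it is void too. *)
Let void_eventE (a b : R) : void_event a b = \bigcup_n dyadic_void a b n.
Proof.
apply/seteqP; split => w; last first.
  move=> [n _]; apply: misses_sub.
    by rewrite lerD2r dyadic_le.
  by rewrite lerD2r ltW// dyadic_gt.
move=> /(misses_wider (@points_locally_finite w))[e e0 m].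
have [n ne] : exists n : nat, (2 ^+ n)^-1 <= e.
  exists (Num.truncn e^-1).+1.
  rewrite invf_ple ?posrE ?exprn_gt0// (le_trans (ltW (truncnS_gt _)))//.
  by rewrite -natrX ler_nat ltnW// ltn_expl.
exists n => //; apply: misses_sub m.
  by have := dyadic_gt n (X w); lra.
by have := dyadic_le n (X w); lra.
Qed.

Lemma measurable_void_event (a b : R) : 0 <= a -> 0 <= b ->
  measurable (void_event a b).
Proof.
move=> a0 b0; rewrite void_eventE; apply: bigcupT_measurable => n.
by have [] := dyadic_voidP n a0 b0.
Qed.

(** Continuity from below: the extra length 2^-n in the rounded probabilities tends to 0. *)
Lemma void_event_prob (a b : R) : 0 <= a -> 0 <= b ->
  P (void_event a b) = (expR (- (lam * (a + b))))%:E.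
Proof.
move=> a0 b0.
have mE n : measurable (dyadic_void a b n) by have [] := dyadic_voidP n a0 b0.
have := @nondecreasing_cvg_mu _ _ _ P _ mE (bigcupT_measurable _ mE)
  (@dyadic_void_nd a b).
rewrite -void_eventE => /cvg_lim <-//; apply/cvg_lim => //.
rewrite (_ : _ \o _ = fun n => (expR (- (lam * (a + b + (2 ^+ n)^-1))))%:E); last first.
  by apply/funext => n /=; have [] := dyadic_voidP n a0 b0.
apply: cvg_EFin; first exact: nearW.
apply: continuous_cvg; first exact: continuous_expR.
apply: cvgN; apply: cvgMr; rewrite -[X in _ --> X]addr0.
apply: cvgD; first exact: cvg_cst.
under eq_cvg do rewrite -exprVn.
by apply: cvg_expr; rewrite ger0_norm; lra.
Qed.

End gaps.

(** * Law of the gaps *)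

Section quadrants.
Context {R : realType}.
Local Notation plane := (measurableTypeR R * measurableTypeR R)%type.

Definition quadrant (a b : R) : set plane := [set z | a < z.1 /\ b < z.2].

Lemma quadrantE (a b : R) :
  quadrant a b = (`]a, +oo[%classic : set (measurableTypeR R)) `*`
                 (`]b, +oo[%classic : set (measurableTypeR R)).
Proof. by apply/seteqP; split => z /=; rewrite !in_itv/= !andbT. Qed.

Lemma measurable_quadrant (a b : R) : measurable (quadrant a b).
Proof. by rewrite quadrantE; apply: measurableX. Qed.

Lemma quadrantI (a b a' b' : R) :
  quadrant a b `&` quadrant a' b' = quadrant (Num.max a a') (Num.max b b').
Proof.
apply/seteqP; split => z; rewrite /quadrant/= !gt_max.
  by move=> [[-> ->] [-> ->]].
by move=> [/andP[-> ->] /andP[-> ->]].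
Qed.

Lemma archimedean_lower_bound (x : R) : exists n : nat, - n%:R < x.
Proof.
exists (Num.truncn (- x)).+1; rewrite ltrNl.
exact: truncnS_gt.
Qed.

Let G : set (set plane) := [set Q | exists a b, Q = quadrant a b].

(** It suffices that both projections are measurable for the sigma-algebra generated by quadrants: a
    half-plane is the union of quadrants whose other bound runs through the negative integers. *)
Lemma measurable_quadrantE :
  (@measurable _ plane : set (set plane)) = <<s G >>.
Proof.
apply/seteqP; split; last first.
  apply: smallest_sub; first exact: sigma_algebra_measurable.
  by move=> _ [a [b ->]]; exact: measurable_quadrant.
apply: smallest_sub; first exact: smallest_sigma_algebra.
have mfst : measurable_fun setT (fst : g_sigma_algebraType G -> measurableTypeR R).
  apply: (measurability _ (RGenOInfty.measurableE R)) => //.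
  move=> _ [_ [x ->] <-]; rewrite setTI.
  rewrite (_ : _ @^-1` _ = \bigcup_n quadrant x (- n%:R)).
    apply: bigcupT_measurable => n; apply: sub_sigma_algebra.
    by exists x, (- n%:R).
  apply/seteqP; split => z /=; rewrite in_itv/= andbT.
    by move=> xz; have [n nz] := archimedean_lower_bound z.2; exists n.
  by move=> [n _ []].
have msnd : measurable_fun setT (snd : g_sigma_algebraType G -> measurableTypeR R).
  apply: (measurability _ (RGenOInfty.measurableE R)) => //.
  move=> _ [_ [x ->] <-]; rewrite setTI.
  rewrite (_ : _ @^-1` _ = \bigcup_n quadrant (- n%:R) x).
    apply: bigcupT_measurable => n; apply: sub_sigma_algebra.
    by exists (- n%:R), x.
  apply/seteqP; split => z /=; rewrite in_itv/= andbT.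
    by move=> xz; have [n nz] := archimedean_lower_bound z.1; exists n.
  by move=> [n _ []].
by rewrite subUset; split => _ [A mA <-]; [exact: mfst|exact: msnd].
Qed.

Lemma eq_measure_quadrant (m1 m2 : {measure set plane -> \bar R}) :
  (forall a b, m1 (quadrant a b) < +oo)%E ->
  (forall a b, m1 (quadrant a b) = m2 (quadrant a b)) ->
  forall A, measurable A -> m1 A = m2 A.
Proof.
move=> fin12 eq12 A mA.
apply: (measure_unique G (fun n => quadrant (- n%:R) (- n%:R))) => //.
- exact: measurable_quadrantE.
- move=> _ _ [a [b ->]] [a' [b' ->]]; rewrite quadrantI.
  by exists (Num.max a a'), (Num.max b b').
- by move=> n; exists (- n%:R), (- n%:R).
- apply/seteqP; split => // z _.
  have [n1 h1] := archimedean_lower_bound z.1.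
  have [n2 h2] := archimedean_lower_bound z.2.
  exists (maxn n1 n2) => //; split.
    by apply: le_lt_trans h1; rewrite lerN2 ler_nat leq_maxl.
  by apply: le_lt_trans h2; rewrite lerN2 ler_nat leq_maxr.
- by move=> _ [a [b ->]].
Qed.

Lemma probability_setI_full d (T : measurableType d) (P : probability T R)
    (A C : set T) : measurable A -> measurable C -> P C = 1%E ->
  P (A `&` C) = P A.
Proof.
move=> mA mC PC.
have PCc : P (~` C) = 0%E by rewrite probability_setC// PC subee.
rewrite [RHS](measureDI P mA mC).
rewrite -[LHS]add0e; congr (_ + _)%E; apply/esym.
apply: (@subset_measure0 _ _ _ P _ (~` C)).
- exact: measurableD.
- exact: measurableC.
- by move=> x [].
- exact: PCc.
Qed.

(** Gap tails are known for nonnegative bounds only. Both measures sit on [quadrant 0 0], and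
    intersecting with it replaces any bounds by their maxima with 0. *)
Lemma eq_probability_quadrant (m1 m2 : probability plane R) :
  (forall a b, 0 <= a -> 0 <= b ->
    m1 (quadrant a b) = m2 (quadrant a b)) ->
  m1 (quadrant 0 0) = 1%E -> forall A, measurable A -> m1 A = m2 A.
Proof.
move=> eq12 m1C; have m2C : m2 (quadrant 0 0) = 1%E by rewrite -eq12.
apply: eq_measure_quadrant => a b.
  by rewrite (le_lt_trans (probability_le1 _ (measurable_quadrant a b)))// ltry.
have mQ := measurable_quadrant.
apply: (etrans (esym (probability_setI_full (mQ a b) (mQ 0 0) m1C))).
apply: (etrans _ (probability_setI_full (mQ a b) (mQ 0 0) m2C)).
by rewrite quadrantI; apply: eq12; rewrite le_max lexx orbT.
Qed.

(** The inverse is x times the power -1 of x^2, whose base is nonnegative; this stays true at 0,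
    where the inverse is 0 by convention. *)
Lemma measurable_inv : measurable_fun setT (@GRing.inv R).
Proof.
rewrite (_ : GRing.inv = fun x : R => x * ((x * x) `^ (-1))).
  apply: measurable_funM => //.
  apply: (measurableT_comp (measurable_powR (-1))).
  exact: measurable_funM.
apply/funext => x; rewrite powR_inv1; last by rewrite -expr2 sqr_ge0.
by have [->|x0] := eqVneq x 0; [rewrite mul0r invr0|field].
Qed.

End quadrants.

(** * Joint law of the scaled gaps and transfer to the score *)

Section gap_law.
Context {R : realType} {d : measure_display} {Om : measurableType d}.
Variables (P : probability Om R) (lam : R) (K : Om -> set R) (X : {RV P >-> R}).
Hypothesis lam0 : 0 < lam.
Hypothesis BP : brownian_poisson_baseline lam K X.
Local Notation plane := (measurableTypeR R * measurableTypeR R)%type.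

Let void := void_event K X.

Let left_gap (w : Om) : measurableTypeR R := X w - left_point (K w) (X w).
Let right_gap (w : Om) : measurableTypeR R := right_point (K w) (X w) - X w.

Let has_left : set Om := [set w | exists2 y, K w y & y <= X w].
Let has_right : set Om := [set w | exists2 y, K w y & X w <= y].

Let nat_bound (x : R) : exists n : nat, x <= n%:R.
Proof. by exists (Num.truncn x).+1; rewrite ltW// truncnS_gt. Qed.

(** This form makes [has_left] measurable and bounds the probability of its complement by every
    [expR (- (lam * n%:R))]. *)
Let has_leftE : ~` has_left = \bigcap_(n : nat) void n%:R 0.
Proof.
apply/seteqP; split => w.
  move=> no n _ y Ky; apply/negP => /andP[_]; rewrite addr0 => yX.
  by apply: no; exists y.
move=> m [y Ky yX]; have [n yn] := nat_bound (X w - y).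
have /negP := m n I y Ky; apply; apply/andP; split; lra.
Qed.

Let has_rightE : ~` has_right = \bigcap_(n : nat) void 0 n%:R.
Proof.
apply/seteqP; split => w.
  move=> no n _ y Ky; apply/negP => /andP[]; rewrite subr0 => yX _.
  by apply: no; exists y.
move=> m [y Ky yX]; have [n yn] := nat_bound (y - X w).
have /negP := m n I y Ky; apply; apply/andP; split; lra.
Qed.

Let mvoid (a b : R) : 0 <= a -> 0 <= b -> measurable (void a b).
Proof. exact: (measurable_void_event lam0 BP). Qed.

Let mleft : measurable has_left.
Proof.
rewrite -[has_left]setCK has_leftE; apply: measurableC.
by apply: bigcapT_measurable => n; exact: mvoid.
Qed.

Let mright : measurable has_right.
Proof.
rewrite -[has_right]setCK has_rightE; apply: measurableC.
by apply: bigcapT_measurable => n; exact: mvoid.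
Qed.

Let null_of_void (E : set Om) : measurable E ->
  (forall n : nat, P E <= (expR (- (lam * n%:R)))%:E)%E -> P E = 0%E.
Proof.
move=> mE h; apply/eqP; rewrite eq_le measure_ge0 andbT.
have fE : P E \is a fin_num by exact: fin_num_measure.
rewrite -(fineK fE) lee_fin leNgt; apply/negP => p0.
(* For this [n], exp (lam n) >= 1 + lam n > 1/P(E), which contradicts the assumed bound. *)
have [n hn] := nat_bound ((lam * fine (P E))^-1).
have := h n; rewrite -(fineK fE) lee_fin expRN; apply/negP; rewrite -ltNge.
rewrite invf_plt ?posrE ?expR_gt0//.
apply: lt_le_trans (expR_ge1Dx _); rewrite ltr_pwDl//.
by rewrite mulrC -ler_pdivrMr// -invfM mulrC.
Qed.

Let Pleft : P has_left = 1%E.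
Proof.
rewrite -[has_left]setCK probability_setC; last exact: measurableC.
rewrite null_of_void ?sube0//; first exact: measurableC.
move=> n; rewrite -[n%:R]addr0 -(void_event_prob lam0 BP)//.
apply: le_measure; rewrite ?inE; [exact: measurableC|exact: mvoid|].
by rewrite has_leftE; exact: bigcap_inf.
Qed.

Let Pright : P has_right = 1%E.
Proof.
rewrite -[has_right]setCK probability_setC; last exact: measurableC.
rewrite null_of_void ?sube0//; first exact: measurableC.
move=> n; rewrite -[n%:R]add0r -(void_event_prob lam0 BP)//.
apply: le_measure; rewrite ?inE; [exact: measurableC|exact: mvoid|].
by rewrite has_rightE; exact: bigcap_inf.
Qed.

Let good := has_left `&` has_right.

Let mgood : measurable good.
Proof. exact: measurableI. Qed.

Let Pgood : P good = 1%E.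
Proof. by rewrite probability_setI_full. Qed.

Let left_gap_gtP w a : has_left w -> 0 <= a ->
  (a < left_gap w) <-> void a 0 w.
Proof.
move=> hw a0; rewrite /void /void_event/= addr0.
exact: (left_gap_gt (points_locally_finite BP w)).
Qed.

Let right_gap_gtP w b : has_right w -> 0 <= b ->
  (b < right_gap w) <-> void 0 b w.
Proof.
move=> hw b0; rewrite /void /void_event/= subr0.
exact: (right_gap_gt (points_locally_finite BP w)).
Qed.

Let left_gap_ge0 w : has_left w -> 0 <= left_gap w.
Proof.
move=> [y Ky yX]; rewrite subr_ge0; apply: ge_sup; first by exists y.
by move=> z [].
Qed.

Let right_gap_ge0 w : has_right w -> 0 <= right_gap w.
Proof.
move=> [y Ky yX]; rewrite subr_ge0; apply: lb_le_inf; first by exists y.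
by move=> z [].
Qed.

Let mX_gt (x : R) : measurable [set w | x < X w].
Proof.
rewrite (_ : mkset _ = X @^-1` `]x, +oo[%classic); last first.
  by apply/seteqP; split => w /=; rewrite in_itv/= andbT.
by rewrite -[_ @^-1` _]setTI; exact: (measurable_funPT X).
Qed.

Let mX_lt (x : R) : measurable [set w | X w < x].
Proof.
rewrite (_ : mkset _ = X @^-1` `]-oo, x[%classic); last first.
  by apply/seteqP; split => w /=; rewrite in_itv/=.
by rewrite -[_ @^-1` _]setTI; exact: (measurable_funPT X).
Qed.

(** On [has_left] the gap exceeds [x >= 0] exactly on a void event, and always exceeds a negative
    [x]. Off [has_left] the supremum of the empty set is 0 and the gap equals [X]. *)
Let measurable_left_gap : measurable_fun setT left_gap.
Proof.
apply: (measurability _ (RGenOInfty.measurableE R)) => //.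
move=> _ [_ [x ->] <-]; rewrite setTI.
rewrite (_ : _ @^-1` _ = (has_left `&` (if x < 0 then setT else void x 0))
    `|` (~` has_left `&` [set w | x < X w])).
  apply: measurableU; apply: measurableI => //; last exact: measurableC.
  by case: ltP => // x0; exact: mvoid.
apply/seteqP; split => w /=; rewrite in_itv/= andbT.
  move=> xw; have [hw|hw] := pselect (has_left w); [left|right].
    by split => //; case: ltP => // x0; apply/(left_gap_gtP hw x0).
  split => //; move: xw; rewrite /left_gap /left_point (_ : mkset _ = set0).
    by rewrite sup0 subr0.
  by apply/seteqP; split => // y [Ky yX]; apply: hw; exists y.
case=> -[hw].
  case: ltP => [x0 _|x0]; last by move/(left_gap_gtP hw x0).
  exact: lt_le_trans (left_gap_ge0 hw).
rewrite /left_gap /left_point (_ : mkset _ = set0); first by rewrite sup0 subr0.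
by apply/seteqP; split => // y [Ky yX]; apply: hw; exists y.
Qed.

Let measurable_right_gap : measurable_fun setT right_gap.
Proof.
apply: (measurability _ (RGenOInfty.measurableE R)) => //.
move=> _ [_ [x ->] <-]; rewrite setTI.
rewrite (_ : _ @^-1` _ = (has_right `&` (if x < 0 then setT else void 0 x))
    `|` (~` has_right `&` [set w | X w < - x])).
  apply: measurableU; apply: measurableI => //; last exact: measurableC.
  by case: ltP => // x0; exact: mvoid.
apply/seteqP; split => w /=; rewrite in_itv/= andbT.
  move=> xw; have [hw|hw] := pselect (has_right w); [left|right].
    by split => //; case: ltP => // x0; apply/(right_gap_gtP hw x0).
  split => //; move: xw; rewrite /right_gap /right_point (_ : mkset _ = set0).
    by rewrite inf0 sub0r ltrNr.
  by apply/seteqP; split => // y [Ky yX]; apply: hw; exists y.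
case=> -[hw].
  case: ltP => [x0 _|x0]; last by move/(right_gap_gtP hw x0).
  exact: lt_le_trans (right_gap_ge0 hw).
rewrite /right_gap /right_point (_ : mkset _ = set0); first by rewrite inf0 sub0r ltrNr.
by apply/seteqP; split => // y [Ky yX]; apply: hw; exists y.
Qed.

Let scaled_gaps (w : Om) : plane := (lam * left_gap w, lam * right_gap w).

Let measurable_scaled_gaps : measurable_fun setT scaled_gaps.
Proof. by apply: measurable_fun_pair; apply: measurable_funM. Qed.

Let scaled_gaps_tail (a b : R) : 0 <= a -> 0 <= b ->
  P (scaled_gaps @^-1` quadrant a b) = (expR (- (a + b)))%:E.
Proof.
move=> a0 b0.
have a0' : 0 <= a / lam by rewrite divr_ge0// ltW.
have b0' : 0 <= b / lam by rewrite divr_ge0// ltW.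
have mQ : measurable (scaled_gaps @^-1` quadrant a b).
  rewrite -[_ @^-1` _]setTI; apply: measurable_scaled_gaps => //.
  exact: measurable_quadrant.
(* Gap inequalities translate into void events only on [good], so both sides are cut down to this
   event of probability 1. *)
rewrite -(probability_setI_full mQ mgood Pgood).
rewrite (_ : _ `&` good = void (a / lam) (b / lam) `&` good).
  rewrite probability_setI_full//; last exact: mvoid.
  rewrite (void_event_prob lam0 BP)//; congr (expR (- _))%:E.
  by field; rewrite gt_eqF.
apply/seteqP; split => w [h gw]; split => //; move: h gw => + [wl wr];
  rewrite /scaled_gaps /quadrant/= -!ltr_pdivrMl// ![lam^-1 * _]mulrC.
  move=> [/(left_gap_gtP wl a0') + /(right_gap_gtP wr b0')].
  rewrite /void /void_event/= addr0 subr0 => m1 m2.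
  exact/misses_split.
move=> /(misses_split _ _ a0' b0')[m1 m2]; split.
  by apply/(left_gap_gtP wl a0'); rewrite /void /void_event/= addr0.
by apply/(right_gap_gtP wr b0'); rewrite /void /void_event/= subr0.
Qed.

Let shape (z : plane) : plane := (z.1 * z.2, z.1 * (1 - z.2)).

Let measurable_shape : measurable_fun setT shape.
Proof.
apply: measurable_fun_pair; apply: measurable_funM => //.
exact: measurable_funB.
Qed.

Let ge0_integral_scaled_gaps (f : plane -> \bar R) :
  measurable_fun setT f -> (forall z, 0 <= f z)%E ->
  (\int[P]_w f (scaled_gaps w) = \int[model]_z f (shape z))%E.
Proof.
move=> mf f0.
pose Y : {mfun Om >-> plane} := mfun_Sub (mem_set measurable_scaled_gaps).
pose Z : {mfun plane >-> plane} := mfun_Sub (mem_set measurable_shape).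
have eYZ A : measurable A -> distribution P Y A = distribution (@model R) Z A.
  apply: eq_probability_quadrant => [a b a0 b0|].
    exact: (etrans (scaled_gaps_tail a0 b0) (esym (model_tail a0 b0))).
  apply: (etrans (scaled_gaps_tail (lexx 0) (lexx 0))).
  by rewrite addr0 oppr0 expR0.
rewrite -(ge0_integral_distribution Y mf f0) -(ge0_integral_distribution Z mf f0).
by apply: eq_measure_integral => A mA _; exact: eYZ.
Qed.

(** The truncation at 0 makes [gap_score_shape] hold at every point; on [good], where the gaps are
    nonnegative, it changes nothing. *)
Let gap_score (z : plane) : R := Num.max 0 (3 * (z.1 * z.2 / (z.1 + z.2))).

Let measurable_gap_score : measurable_fun setT gap_score.
Proof.
apply: measurable_maxr => //; do 2 apply: measurable_funM => //.
  exact: measurable_funM.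
by apply: (measurableT_comp (@measurable_inv R)); exact: measurable_funD.
Qed.

Let gap_score_shape (z : plane) : gap_score (shape z) = score z.
Proof.
rewrite /gap_score /score /shape/=; congr (Num.max 0 (3 * _)).
rewrite -mulrDr (_ : z.2 + (1 - z.2) = 1) ?mulr1; last by ring.
have [->|z0] := eqVneq z.1 0; first by rewrite !mul0r.
by field.
Qed.

Let scaled_varianceE w : 3 * lam * task_variance K X w =
  3 * ((scaled_gaps w).1 * (scaled_gaps w).2
       / ((scaled_gaps w).1 + (scaled_gaps w).2)).
Proof.
rewrite /task_variance /posterior_variance /scaled_gaps/=.
rewrite -/(left_gap w) -/(right_gap w).
have -> : right_point (K w) (X w) - left_point (K w) (X w) =
    left_gap w + right_gap w by rewrite /left_gap /right_gap; ring.
(* When the total gap is 0, both sides are 0 because division by 0 yields 0. *)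
rewrite -mulrDr; have [->|s0] := eqVneq (left_gap w + right_gap w) 0.
  by rewrite mulr0 invr0 !mulr0.
by field; rewrite s0 gt_eqF.
Qed.

Lemma measurable_scaled_variance :
  measurable_fun setT (fun w => 3 * lam * task_variance K X w).
Proof.
rewrite (_ : (fun _ => _) = (fun z : plane => 3 * (z.1 * z.2 / (z.1 + z.2)))
    \o scaled_gaps); last by apply/funext => w; exact: scaled_varianceE.
apply: measurableT_comp => //; do 2 apply: measurable_funM => //.
  exact: measurable_funM.
by apply: (measurableT_comp (@measurable_inv R)); exact: measurable_funD.
Qed.

(** One transfer serves both the utility and its derivative. Nonnegativity is asked only for
    [0 <= v] because v 1{v < r} is negative for negative [v]; off [good], where the variance may be
    negative, the integrands may differ. *)
Lemma integral_scaled_variance (f : R -> R) : measurable_fun setT f ->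
  (forall v, 0 <= v -> 0 <= f v) ->
  (\int[P]_w (f (3 * lam * task_variance K X w)%R)%:E =
   \int[model]_z (f (score z))%:E)%E.
Proof.
move=> mf f0.
have null_good : P (~` good) = 0%E by rewrite probability_setC// Pgood subee.
have mfg : measurable_fun setT (fun z => (f (gap_score z))%:E).
  by apply/measurable_EFinP; apply: measurableT_comp.
transitivity (\int[P]_w (f (gap_score (scaled_gaps w)))%:E)%E.
  apply: ae_eq_integral => //.
  - apply/measurable_EFinP; apply: measurableT_comp => //.
    exact: measurable_scaled_variance.
  - exact: (measurableT_comp mfg).
  - exists (~` good); split; first exact: measurableC.
      exact: null_good.
    move=> w /= nw [wl wr]; apply: nw => _; congr (f _)%:E.
    rewrite scaled_varianceE /gap_score (elimT max_idPr)// mulr_ge0//.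
    have l0 : 0 <= (scaled_gaps w).1 by rewrite mulr_ge0 ?(ltW lam0)// left_gap_ge0.
    have r0 : 0 <= (scaled_gaps w).2 by rewrite mulr_ge0 ?(ltW lam0)// right_gap_ge0.
    by apply: divr_ge0; [exact: mulr_ge0|exact: addr_ge0].
rewrite (ge0_integral_scaled_gaps mfg); last first.
  by move=> z; rewrite lee_fin f0// le_max lexx.
by apply: eq_integral => z _; rewrite gap_score_shape.
Qed.

End gap_law.

Theorem proposition2 (R : realType) :
  exists u : R -> R,
    [/\ utility_function u,
        (forall r : R, 0 < r -> 0 < u r) /\
        (forall r s : R, 0 < r -> r < s -> u r < u s) /\
        (forall r : R, 0 < r ->
           [/\ derivable u r 1,
               0 < derive1 u r < 1 / r ^+ 2 &
               forall (d : measure_display) (Om : measurableType d)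
                 (P : probability Om R) (lam : R) (K : Om -> set R)
                 (X : {RV P >-> R}),
                 0 < lam -> brownian_poisson_baseline lam K X ->
                 (derive1 u r)%:E =
                   ((1 / r ^+ 2)%:E *
                    'E_P[(fun w => (3 * lam * task_variance K X w) *
                       \1_[set w' | 3 * lam * task_variance K X w' < r] w)%R])%E])
      & forall r : R, 0 < r ->
          (u r)%:E =
            (\int[lebesgue_measure]_(t in `]0%R, 1%R[)
               (1 - 6 * t * (1 - t) / r
                + (1 + 6 * t * (1 - t) / r)
                  * expR (- (r / (3 * t * (1 - t)))))%R%:E)%E ].
Proof.
exists utility; split.
- move=> d Om P lam q K X lam0 q0 BP.
  have r0 : 0 < 3 * lam * q by rewrite !mulr_gt0.
  rewrite /calibrated_utility unlock utilityE// /mean_utility.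
  (* Dividing the scaled variance by [3 * lam * q] cancels [3 * lam] and leaves the ratio of the
     variance to [q]. *)
  rewrite -(integral_scaled_variance lam0 BP
    (f := fun v => Num.max (1 - v / (3 * lam * q)) 0)).
  + apply: eq_integral => w _; congr (Num.max (1 - _) 0)%:E.
    by field; rewrite !gt_eqF.
  + apply: measurable_maxr => //; apply: measurable_funB => //.
    exact: measurable_funM.
  + by move=> v _; rewrite le_max lexx orbT.
- split; first exact: utility_gt0.
  split; first exact: utility_increasing.
  move=> r r0; have D := is_derive_utility r0.
  have uE : derive1 utility r = censored r / r ^+ 2.
    by rewrite derive1E; exact: derive_val.
  split; first exact: ex_derive.
  + rewrite uE divr_gt0 ?censored_gt0 ?exprn_gt0//=.
    by rewrite ltr_pM2r ?invr_gt0 ?exprn_gt0// censored_lt1.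
  + move=> d Om P lam K X lam0 BP.
    rewrite uE mulrC EFinM censoredE div1r unlock /censored_mean.
    congr (_ * _)%E.
    pose f v := v * \1_[set v' | v' < r] v.
    transitivity (\int[P]_w (f (3 * lam * task_variance K X w)%R)%:E)%E.
      rewrite (integral_scaled_variance lam0 BP).
      * by apply: eq_integral => z _; rewrite /f !indicE !in_setb.
      * apply: measurable_funM => //; apply: measurable_indic.
        by rewrite -set_itvNyo.
      * by move=> v v0; rewrite mulr_ge0.
    by apply: eq_integral => w _; rewrite /f !indicE !in_setb.
- by move=> r r0; rewrite utilityE// mean_utilityE.
Qed.
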